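(* The coproduct of two graph operator systems is not necessarily a graph operator system. That is, there exist $n\in\mathbb{N}$ and two graph operator systems $\mathcal{S}_{G_1},\mathcal{S}_{G_2}\subseteq M_n$ whose coproduct $\mathcal{S}_{G_1}\oplus_{\mathcal{D}_n}\mathcal{S}_{G_2}$ is not completely order isomorphic to any operator system $\mathcal{S}_{G'}\subseteq M_k$ that is a bimodule over $\mathcal{D}_k$, for any $k\in\mathbb{N}$. In fact, this coproduct cannot even be completely order isomorphic to any operator system acting on a finite dimensional Hilbert space.
   Context: $M_n=M_n(\mathbb{C})$, and $\mathcal{D}_n\subseteq M_n$ is the $C^*$-algebra of diagonal matrices. For a graph $G=(V,E)$ on $n$ vertices, its graph operator system is $\mathcal{S}_G=\{T\in M_n : T_{i,j}\neq0\Rightarrow i=j\text{ or }(i,j)\in E\}$. It is a $\mathcal{D}_n$-bimodule under matrix multiplication, and so a faithful operator $\mathcal{D}_n$-system. An operator system is a matrix ordered $*$-vector space with an Archimedean matrix order unit $e$. ''Ucp'' means unital completely positive. For a unital $C^*$-algebra $\mathcal{A}$, an operator system $\mathcal{S}$ is an operator $\mathcal{A}$-system if it is a (unital) $\mathcal{A}$-bimodule such that $(a\cdot s)^*=s^*\cdot a^*$, $a\cdot e=e\cdot a$, and $[a_{ij}]\cdot[s_{ij}]\cdot[a_{ij}]^*\in M_n(\mathcal{S})^+$ for all $a\in\mathcal{A}$, $s\in\mathcal{S}$, $[a_{ij}]\in M_{n,m}(\mathcal{A})$, $[s_{ij}]\in M_m(\mathcal{S})^+$; it is faithful if $a\cdot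 e\ne0$ for all $a\neq0$. A linear map $\phi$ between operator $\mathcal{A}$-systems is an $\mathcal{A}$-bimodule map if $\phi(a_1\cdot s\cdot a_2)=a_1\cdot\phi(s)\cdot a_2$. Coproduct: for faithful operator $\mathcal{A}$-systems $\mathcal{S}_1,\mathcal{S}_2$, the coproduct $\mathcal{S}_1\oplus_{\mathcal{A}}\mathcal{S}_2$ is the unique faithful operator $\mathcal{A}$-system, together with unital complete order embeddings $\phi_i:\mathcal{S}_i\hookrightarrow\mathcal{S}_1\oplus_{\mathcal{A}}\mathcal{S}_2$ that are $\mathcal{A}$-bimodule maps, such that for every operator $\mathcal{A}$-system $\mathcal{R}$ and ucp $\mathcal{A}$-bimodule maps $\psi_i:\mathcal{S}_i\to\mathcal{R}$ ($i=1,2$) there is a unique ucp $\mathcal{A}$-bimodule map $\Psi$ on $\mathcal{S}_1\oplus_{\mathcal{A}}\mathcal{S}_2$ with $\Psi\circ\phi_i=\psi_i$. *)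

(* Defs.v *)
(* The complex numbers are R[i], for an arbitrary R : realType. *)
From HB Require Import structures.
From mathcomp Require Import all_boot all_order all_algebra.
From mathcomp Require Import spectral reals.
From mathcomp Require Import complex.

Set Implicit Arguments.
Unset Strict Implicit.
Unset Printing Implicit Defensive.

Import Order.TTheory GRing.Theory Num.Theory.
Local Open Scope ring_scope.
Local Open Scope sesquilinear_scope.

Section VectorSpaceMatrices.
Variables (R : realType) (V : lmodType R[i]).

Definition mxstar (star : V -> V) m (x : 'M[V]_m) : 'M[V]_m :=
  (map_mx star x)^T.

Definition realscale m (r : R) (x : 'M[V]_m) : 'M[V]_m :=
  map_mx (fun v => (r%:C)%C *: v) x.

(* The V-valued matrix product X x X^*, for a scalar matrix X. *)
Definition mxcompress p m (X : 'M[R[i]]_(p, m)) (x : 'M[V]_m) : 'M[V]_p :=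
  \matrix_(i, j) \sum_k \sum_l (X i k * Num.conj (X j l)) *: x k l.

End VectorSpaceMatrices.

(* Abstract (Choi-Effros) operator systems: matrix ordered *-vector spaces with
   an Archimedean matrix order unit. [os_pos m] is the cone M_m(S)^+, and
   [os_unit%:M] is the diagonal matrix with all diagonal entries [os_unit]. *)
Record opSystem (R : realType) := OpSystem {
  os_sort :> lmodType R[i];
  os_star : os_sort -> os_sort;
  os_pos : forall m, 'M[os_sort]_m -> Prop;
  os_unit : os_sort;
  os_star_semilinear : forall (c : R[i]) (x y : os_sort),
    os_star (c *: x + y) = Num.conj c *: os_star x + os_star y;
  os_starK : involutive os_star;
  os_pos_selfadj : forall m (x : 'M[os_sort]_m),
    os_pos x -> mxstar os_star x = x;
  os_pos0 : forall m, os_pos (0 : 'M[os_sort]_m);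
  os_posD : forall m (x y : 'M[os_sort]_m),
    os_pos x -> os_pos y -> os_pos (x + y);
  os_posZ : forall m (r : R) (x : 'M[os_sort]_m),
    0 <= r -> os_pos x -> os_pos (realscale r x);
  os_pos_proper : forall m (x : 'M[os_sort]_m),
    os_pos x -> os_pos (- x) -> x = 0;
  os_pos_compress : forall p m (X : 'M[R[i]]_(p, m)) (x : 'M[os_sort]_m),
    os_pos x -> os_pos (mxcompress X x);
  os_unit_selfadj : os_star os_unit = os_unit;
  os_order_unit : forall m (x : 'M[os_sort]_m), mxstar os_star x = x ->
    exists r : R, 0 < r /\ os_pos (realscale r os_unit%:M + x);
  os_archimedean : forall m (x : 'M[os_sort]_m),
    (forall r : R, 0 < r -> os_pos (realscale r os_unit%:M + x)) -> os_pos x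
}.

Section Maps.
Variables (R : realType) (S T : opSystem R).

Definition cp (f : S -> T) : Prop :=
  forall m (x : 'M[S]_m), os_pos x -> os_pos (map_mx f x).

Definition unital (f : S -> T) : Prop := f (os_unit S) = os_unit T.

Definition ucp (f : S -> T) : Prop := unital f /\ cp f.

Definition complete_order_embedding (f : S -> T) : Prop :=
  injective f /\ forall m (x : 'M[S]_m), os_pos x <-> os_pos (map_mx f x).

End Maps.

(* The isomorphism is not required to be unital. *)
Definition completely_order_isomorphic (R : realType) (S T : opSystem R) :
    Prop :=
  exists (f : {linear S -> T}) (g : {linear T -> S}),
    [/\ cancel f g, cancel g f, cp f & cp g].

(* The *-algebra data underlying a unital C*-algebra; the definition of an
   operator A-system refers to nothing else. *)
Record starAlg (R : realType) := StarAlg {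
  sa_sort :> algType R[i];
  sa_star : sa_sort -> sa_sort;
  sa_star_semilinear : forall (c : R[i]) (a b : sa_sort),
    sa_star (c *: a + b) = Num.conj c *: sa_star a + sa_star b;
  sa_starM : forall a b : sa_sort, sa_star (a * b) = sa_star b * sa_star a;
  sa_starK : involutive sa_star
}.

Record opASystem (R : realType) (A : starAlg R) := OpASystem {
  oas_sys :> opSystem R;
  lact : A -> oas_sys -> oas_sys;
  ract : oas_sys -> A -> oas_sys;
  lact_linearl : forall (c : R[i]) (a b : A) (s : oas_sys),
    lact (c *: a + b) s = c *: lact a s + lact b s;
  lact_linearr : forall (c : R[i]) (a : A) (s t : oas_sys),
    lact a (c *: s + t) = c *: lact a s + lact a t;
  ract_linearl : forall (c : R[i]) (a : A) (s t : oas_sys),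
    ract (c *: s + t) a = c *: ract s a + ract t a;
  ract_linearr : forall (c : R[i]) (a b : A) (s : oas_sys),
    ract s (c *: a + b) = c *: ract s a + ract s b;
  lact1 : forall s : oas_sys, lact 1 s = s;
  ract1 : forall s : oas_sys, ract s 1 = s;
  lactA : forall (a b : A) (s : oas_sys), lact (a * b) s = lact a (lact b s);
  ractA : forall (a b : A) (s : oas_sys), ract s (a * b) = ract (ract s a) b;
  lractA : forall (a b : A) (s : oas_sys),
    ract (lact a s) b = lact a (ract s b);
  star_lact : forall (a : A) (s : oas_sys),
    os_star (lact a s) = ract (os_star s) (sa_star a);
  act_unit : forall a : A, lact a (os_unit oas_sys) = ract (os_unit oas_sys) a;
  act_pos : forall p m (a : 'M[A]_(p, m)) (s : 'M[oas_sys]_m), os_pos s ->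
    os_pos (\matrix_(i < p, j < p)
      \sum_k \sum_l ract (lact (a i k) (s k l)) (sa_star (a j l)))
}.

Section Coproduct.
Variables (R : realType) (A : starAlg R).

Definition faithful (S : opASystem A) : Prop :=
  forall a : A, a != 0 -> lact a (os_unit S) <> 0.

Definition bimodule_map (S T : opASystem A) (f : S -> T) : Prop :=
  forall (a b : A) (s : S), f (ract (lact a s) b) = ract (lact a (f s)) b.

Definition is_coproduct (S1 S2 P : opASystem A)
    (phi1 : {linear S1 -> P}) (phi2 : {linear S2 -> P}) : Prop :=
  [/\ faithful P,
      [/\ unital phi1, complete_order_embedding phi1 & bimodule_map phi1],
      [/\ unital phi2, complete_order_embedding phi2 & bimodule_map phi2]
    & forall (Q : opASystem A)
             (psi1 : {linear S1 -> Q}) (psi2 : {linear S2 -> Q}),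
        ucp psi1 -> bimodule_map psi1 -> ucp psi2 -> bimodule_map psi2 ->
        let extends (Psi : {linear P -> Q}) :=
          [/\ ucp Psi, bimodule_map Psi,
              forall s, Psi (phi1 s) = psi1 s
            & forall s, Psi (phi2 s) = psi2 s] in
        exists2 Psi, extends Psi & forall Psi', extends Psi' -> Psi' =1 Psi].

End Coproduct.

Section SesquilinearForms.
Variables (C : numClosedFieldType) (T : finType).
Implicit Types (F : T -> T -> C) (u v w : T -> C).

Definition sform F u v := \sum_p \sum_q Num.conj (u p) * F p q * v q.

Lemma sformDl F u v w :
  sform F (fun p => u p + v p) w = sform F u w + sform F v w.
Proof.
rewrite /sform -big_split; apply: eq_bigr => p _.
rewrite -big_split; apply: eq_bigr => q _.
by rewrite rmorphD /= !mulrDl.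
Qed.

Lemma sformDr F u v w :
  sform F w (fun p => u p + v p) = sform F w u + sform F w v.
Proof.
rewrite /sform -big_split; apply: eq_bigr => p _.
rewrite -big_split; apply: eq_bigr => q _.
by rewrite mulrDr.
Qed.

Lemma sform_delta F a b (c d : C) :
  sform F (fun p => c *+ (p == a)) (fun p => d *+ (p == b)) =
  Num.conj c * F a b * d.
Proof.
rewrite /sform (bigD1 a) //= [X in _ + X]big1 ?addr0; last first.
  by move=> p /negPf pa; rewrite big1 // => q _; rewrite pa conjC0 !mul0r.
rewrite (bigD1 b) //= [X in _ + X]big1 ?addr0 ?eqxx //.
by move=> q /negPf qb; rewrite qb mulr0.
Qed.

Lemma sform_eq0 F : (forall v, sform F v v = 0) -> forall p q, F p q = 0.
Proof.
move=> F0 p q.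
have D r : F r r = 0.
  have := F0 (fun p => 1 *+ (p == r)).
  by rewrite sform_delta conjC1 mul1r mulr1.
have E c : F p q * c + Num.conj c * F q p = 0.
  have := F0 (fun r => 1 *+ (r == p) + c *+ (r == q)).
  rewrite sformDl !sformDr !sform_delta !D conjC1 !mulr0 !mul0r !mul1r mulr1.
  by rewrite addr0 add0r.
have E1 := E 1; have Ei := E 'i.
rewrite mulr1 conjC1 mul1r in E1.
move/addr0_eq: E1 => E1.
rewrite conjCi -E1 mulNr mulrN opprK [_ * 'i]mulrC -mulr2n in Ei.
move/eqP: Ei; rewrite mulrn_eq0 /= mulf_eq0.
by rewrite (negPf (neq0Ci _)) /= => /eqP.
Qed.

Lemma sform_herm F :
  (forall v, 0 <= sform F v v) -> forall p q, F p q = Num.conj (F q p).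
Proof.
move=> F0 p q; apply/eqP; rewrite -subr_eq0; apply/eqP.
apply: (@sform_eq0 (fun p q => F p q - Num.conj (F q p))) => v.
have -> : sform (fun p q => F p q - Num.conj (F q p)) v v =
          sform F v v - Num.conj (sform F v v).
  rewrite /sform rmorph_sum /=.
  under [X in _ = _ - X]eq_bigr do rewrite rmorph_sum.
  rewrite [X in _ = _ - X]exchange_big -sumrB; apply: eq_bigr => a _.
  rewrite -sumrB; apply: eq_bigr => b _.
  rewrite !rmorphM /= conjCK mulrBr mulrBl; congr (_ - _).
  by rewrite mulrC mulrCA mulrC.
by apply/eqP; rewrite subr_eq0 eq_sym; apply/eqP/CrealP; apply: ger0_real.
Qed.

Lemma normM_le (x y : C) : `|x| * `|y| <= `|x| ^+ 2 + `|y| ^+ 2.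
Proof.
have xr : `|x| \is Num.real by apply: normr_real.
have yr : `|y| \is Num.real by apply: normr_real.
have /orP[xy|yx] := real_leVge xr yr.
- apply: (@le_trans _ _ (`|y| ^+ 2)).
    by rewrite expr2 ler_wpM2r.
  by rewrite lerDr exprn_ge0.
- apply: (@le_trans _ _ (`|x| ^+ 2)).
    by rewrite expr2 ler_wpM2l.
  by rewrite lerDl exprn_ge0.
Qed.

Lemma sform_bound F v :
  `|sform F v v| <= (\sum_p \sum_q (`|F p q| *+ 2)) * \sum_p `|v p| ^+ 2.
Proof.
apply: le_trans (ler_norm_sum _ _ _) _; rewrite mulr_suml.
apply: ler_sum => p _.
apply: le_trans (ler_norm_sum _ _ _) _; rewrite mulr_suml.
apply: ler_sum => q _.
rewrite !normrM norm_conjC mulrAC [_ * `|F p q|]mulrC mulrnAl -mulrnAr.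
apply: ler_wpM2l => //.
have vle r : `|v r| ^+ 2 <= \sum_p `|v p| ^+ 2.
  rewrite (bigD1 r) //= lerDl; apply: sumr_ge0 => s _; exact: exprn_ge0.
by apply: le_trans (normM_le _ _) _; rewrite mulr2n lerD.
Qed.

End SesquilinearForms.

Section MatrixPositivity.
Variable R : realType.
Local Notation C := R[i].

(* x >= 0 as an operator on the direct sum of m copies of C^k; the order of
   R[i] makes [0 <= z] imply that z is real. *)
Definition mxpos k m (x : 'M['M[C]_k]_m) : Prop :=
  forall v : 'I_m -> 'cV[C]_k,
    0 <= \sum_i \sum_j ((v i)^t* *m x i j *m v j) 0 0.

Variable k : nat.

Definition flatmx m (x : 'M['M[C]_k]_m) (p q : 'I_m * 'I_k) : C :=
  x p.1 q.1 p.2 q.2.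

Lemma sform_flat m (x : 'M['M[C]_k]_m) (v : 'I_m -> 'cV[C]_k) :
  \sum_i \sum_j ((v i)^t* *m x i j *m v j) 0 0 =
  sform (flatmx x) (fun p => v p.1 p.2 0) (fun p => v p.1 p.2 0).
Proof.
rewrite /sform -(pair_bigA _ (fun i a => \sum_q
  Num.conj (v i a 0) * flatmx x (i, a) q * v q.1 q.2 0)) /=.
apply: eq_bigr => i _; rewrite exchange_big /=.
rewrite -(pair_bigA _ (fun j b => \sum_a
  Num.conj (v i a 0) * flatmx x (i, a) (j, b) * v j b 0)) /=.
apply: eq_bigr => j _; rewrite mxE; apply: eq_bigr => b _.
by rewrite mxE mulr_suml; apply: eq_bigr => a _; rewrite !mxE.
Qed.

Lemma mxposP m (x : 'M['M[C]_k]_m) :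
  mxpos x <-> forall v, 0 <= sform (flatmx x) v v.
Proof.
split=> [x0 v | x0 v]; last by rewrite sform_flat.
have := x0 (fun i => \col_a v (i, a)); rewrite sform_flat.
congr (0 <= _); apply: eq_bigr => -[i a] _; apply: eq_bigr => -[j b] _.
by rewrite !mxE.
Qed.

Lemma mxpos_selfadj m (x : 'M['M[C]_k]_m) :
  mxpos x -> forall i j, (x j i)^t* = x i j.
Proof.
move=> /mxposP x0 i j; apply/matrixP => a b; rewrite !mxE.
by have := sform_herm x0 (i, a) (j, b); rewrite /flatmx /= => ->.
Qed.

Lemma mxpos0 m : mxpos (0 : 'M['M[C]_k]_m).
Proof.
move=> v; rewrite big1 // => i _; rewrite big1 // => j _.
have -> : (0 : 'M['M[C]_k]_m) i j = 0 by rewrite mxE.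
by rewrite mulmx0 mul0mx mxE.
Qed.

Lemma mxposD m (x y : 'M['M[C]_k]_m) : mxpos x -> mxpos y -> mxpos (x + y).
Proof.
move=> x0 y0 v; have := addr_ge0 (x0 v) (y0 v).
rewrite -big_split /=; congr (0 <= _); apply: eq_bigr => i _.
rewrite -big_split /=; apply: eq_bigr => j _.
have -> : (x + y) i j = x i j + y i j by rewrite mxE.
by rewrite mulmxDr mulmxDl [RHS]mxE.
Qed.

Lemma mxposZ m (c : C) (x : 'M['M[C]_k]_m) :
  0 <= c -> mxpos x -> mxpos (map_mx (fun z => c *: z) x).
Proof.
move=> c0 x0 v; have := mulr_ge0 c0 (x0 v).
rewrite mulr_sumr; congr (0 <= _); apply: eq_bigr => i _.
rewrite mulr_sumr; apply: eq_bigr => j _.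
have -> : map_mx (fun z => c *: z) x i j = c *: x i j by rewrite mxE.
by rewrite -scalemxAr -scalemxAl [RHS]mxE.
Qed.

Lemma mxpos_proper m (x : 'M['M[C]_k]_m) : mxpos x -> mxpos (- x) -> x = 0.
Proof.
move=> /mxposP x0 /mxposP xN.
have F0 v : sform (flatmx x) v v = 0.
  apply/le_anti; rewrite x0 andbT -oppr_ge0.
  have := xN v; congr (0 <= _); rewrite /sform -sumrN.
  apply: eq_bigr => p _; rewrite -sumrN; apply: eq_bigr => q _.
  by rewrite /flatmx !mxE mulrN mulNr.
apply/matrixP => i j; apply/matrixP => a b.
by have := sform_eq0 F0 (i, a) (j, b); rewrite /flatmx /= !mxE.
Qed.

Lemma mxpos_compress p m (a : 'M['M[C]_k]_(p, m)) (x : 'M['M[C]_k]_m) :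
  mxpos x ->
  mxpos (\matrix_(i < p, j < p) \sum_q \sum_l a i q *m x q l *m (a j l)^t*).
Proof.
move=> x0 v; have := x0 (fun q => \sum_i (a i q)^t* *m v i).
congr (0 <= _).
pose G i j q l := ((v i)^t* *m (a i q *m x q l *m (a j l)^t*) *m v j) 0 0.
transitivity (\sum_q \sum_l \sum_i \sum_j G i j q l).
  apply: eq_bigr => q _; apply: eq_bigr => l _.
  have -> : (\sum_i (a i q)^t* *m v i)^t* = \sum_i ((a i q)^t* *m v i)^t*.
    apply/matrixP => b c; rewrite !mxE !summxE rmorph_sum /=.
    by apply: eq_bigr => i _; rewrite [RHS]mxE [in RHS]mxE.
  rewrite !mulmx_suml summxE; apply: eq_bigr => i _.
  rewrite mulmx_sumr summxE; apply: eq_bigr => j _.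
  by rewrite /G trmx_mul map_mxM /= trmxCK !mulmxA.
under eq_bigr do rewrite exchange_big /=.
rewrite exchange_big /=; apply: eq_bigr => i _.
under eq_bigr do rewrite exchange_big /=.
rewrite exchange_big /=; apply: eq_bigr => j _.
set B := \matrix_(i, j) _.
have -> : B i j = \sum_q \sum_l a i q *m x q l *m (a j l)^t* by rewrite mxE.
rewrite mulmx_sumr mulmx_suml summxE; apply: eq_bigr => q _.
by rewrite mulmx_sumr mulmx_suml summxE; apply: eq_bigr => l _.
Qed.

Lemma sform_one m (v : 'I_m * 'I_k -> C) :
  sform (flatmx (1%:M)%:M) v v = \sum_p `|v p| ^+ 2.
Proof.
apply: eq_bigr => -[i a] _; rewrite (bigD1 (i, a)) //= [X in _ + X]big1.
  by rewrite addr0 /flatmx /= !mxE !eqxx mxE eqxx mulr1n normCK mulrC mulr1.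
move=> [j b]; rewrite xpair_eqE /flatmx /= mxE => n0.
case: (eqVneq i j) n0 => [->|_ _]; last by rewrite mulr0n mxE mulr0 mul0r.
by rewrite mxE [b == a]eq_sym /= => /negPf ->; rewrite mulr0 mul0r.
Qed.

Lemma sform_shift m (c : C) (x : 'M['M[C]_k]_m) v :
  sform (flatmx (map_mx (fun z => c *: z) (1%:M)%:M + x)) v v =
  c * (\sum_p `|v p| ^+ 2) + sform (flatmx x) v v.
Proof.
rewrite -sform_one /sform mulr_sumr -big_split /=; apply: eq_bigr => p _.
rewrite mulr_sumr -big_split /=; apply: eq_bigr => q _.
rewrite /flatmx /= !mxE mulrDr mulrDl; congr (_ + _).
by rewrite mulrCA -mulrA mulrA -!mulrA.
Qed.

Lemma mxpos_order_unit m (x : 'M['M[C]_k]_m) :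
  (forall i j, (x j i)^t* = x i j) ->
  exists r : R, 0 < r /\
    mxpos (map_mx (fun z => (r%:C)%C *: z) (1%:M)%:M + x).
Proof.
move=> xsa; pose M := \sum_p \sum_q (`|flatmx x p q| *+ 2).
have M0 : 0 <= M.
  apply: sumr_ge0 => p _; apply: sumr_ge0 => q _.
  by rewrite mulrn_wge0.
have Mr : M = ((complex.Re M)%:C)%C.
  by move: M0; case: (M) => a b; rewrite lecE /= => /andP[/eqP ->].
exists (complex.Re M + 1); split.
  rewrite ltr_wpDl // -lecR -Mr //.
apply/mxposP => v; rewrite sform_shift rmorphD /= -Mr rmorph1 mulrDl mul1r.
have fr : sform (flatmx x) v v \is Num.real.
  apply/CrealP; rewrite /sform rmorph_sum /=.
  under eq_bigr do rewrite rmorph_sum.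
  rewrite exchange_big; apply: eq_bigr => p _; apply: eq_bigr => q _.
  rewrite !rmorphM /= conjCK mulrC [v q * _]mulrC mulrA.
  congr (_ * _ * _).
  by rewrite /flatmx -(xsa p.1 q.1) !mxE.
have S0 : 0 <= \sum_p `|v p| ^+ 2.
  by apply: sumr_ge0 => p _; exact: exprn_ge0.
have := sform_bound (flatmx x) v; rewrite -/M => B.
rewrite addrAC addr_ge0 // -lerBlDr sub0r.
by apply: le_trans B; rewrite -normrN real_ler_norm // rpredN.
Qed.

Lemma mxpos_archimedean m (x : 'M['M[C]_k]_m) :
  (forall r : R, 0 < r ->
    mxpos (map_mx (fun z => (r%:C)%C *: z) (1%:M)%:M + x)) -> mxpos x.
Proof.
move=> xr; apply/mxposP => v.
set q := sform _ v v; set S := \sum_p `|v p| ^+ 2.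
have S0 : 0 <= S by apply: sumr_ge0 => p _; exact: exprn_ge0.
have H r : 0 < r -> 0 <= (r%:C)%C * S + q.
  by move=> r0; have /mxposP/(_ v) := xr r r0; rewrite sform_shift.
clearbody q S; case: S S0 H => s s'; rewrite lecE /= => /andP[/eqP -> s0] H.
case: q H => a b H.
have := H 1 ltr01; rewrite lecE /= => /andP[/eqP].
rewrite !(mulr0, mul0r, addr0, add0r, oppr0) => -> _.
rewrite lecE /= eqxx /= leNgt; apply/negP => a0.
have s1 : 0 < s + 1 by rewrite ltr_wpDl.
have r0 : 0 < - a / (s + 1) by rewrite divr_gt0 // oppr_gt0.
have := H _ r0; rewrite lecE /= => /andP[_].
rewrite !(mulr0, mul0r, addr0, add0r, oppr0) leNgt => /negP; apply.
rewrite -ltrBrDr sub0r mulrAC ltr_pdivrMr // ltr_pM2l ?oppr_gt0 //.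
by rewrite ltrDl.
Qed.

End MatrixPositivity.

(* Operator systems acting on the Hilbert space C^k: unital self-adjoint
   subspaces of M_k, with the matrix order inherited from M_k. *)
Record matrixOS (R : realType) (k : nat) := MatrixOS {
  mos_set :> submodClosed 'M[R[i]]_k;
  mos_unit : 1%:M \in mos_set;
  mos_star : forall A, A \in mos_set -> A^t* \in mos_set
}.

Section MatrixOperatorSystems.
Variables (R : realType) (k : nat) (S : matrixOS R k).

Record mos_elt := MosElt { mos_val :> 'M[R[i]]_k; _ : mos_val \in mos_set S }.

HB.instance Definition _ := [isSub for mos_val].
HB.instance Definition _ := [Choice of mos_elt by <:].
HB.instance Definition _ := [SubChoice_isSubLmodule of mos_elt by <:].

Definition mos_adj (x : mos_elt) : mos_elt := MosElt (mos_star (valP x)).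

Definition mos_pos m (x : 'M[mos_elt]_m) : Prop := mxpos (map_mx mos_val x).

Definition mos_one : mos_elt := MosElt (mos_unit S).

Lemma mos_val_shift m (c : R[i]) (x : 'M[mos_elt]_m) :
  map_mx mos_val (map_mx (fun v => c *: v) mos_one%:M + x) =
  map_mx (fun z => c *: z) (1%:M)%:M + map_mx mos_val x.
Proof.
apply/matrixP => i j; rewrite !mxE /=.
by case: (i == j); rewrite /= ?mulr1n ?mulr0n.
Qed.

Lemma mos_val_inj m : injective (@map_mx mos_elt _ mos_val m m).
Proof.
move=> x y /matrixP xy; apply/matrixP => i j; apply: val_inj.
by have := xy i j; rewrite !mxE.
Qed.

Lemma mos_val_sum m (F : 'I_m -> mos_elt) :
  mos_val (\sum_i F i) = \sum_i mos_val (F i).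
Proof. exact: (raddf_sum val). Qed.

Fact mos_star_semilinear (c : R[i]) (x y : mos_elt) :
  mos_adj (c *: x + y) = Num.conj c *: mos_adj x + mos_adj y.
Proof.
by apply: val_inj => /=; apply/matrixP => i j; rewrite !mxE rmorphD rmorphM.
Qed.

Fact mos_starK : involutive mos_adj.
Proof. by move=> x; apply: val_inj; rewrite /= trmxCK. Qed.

Fact mos_pos_selfadj m (x : 'M[mos_elt]_m) : mos_pos x -> mxstar mos_adj x = x.
Proof.
move=> x0; apply/matrixP => i j; apply: val_inj; rewrite !mxE /=.
by have := mxpos_selfadj x0 i j; rewrite !mxE.
Qed.

Fact mos_pos0 m : mos_pos (0 : 'M[mos_elt]_m).
Proof.
rewrite /mos_pos; have -> : map_mx mos_val (0 : 'M[mos_elt]_m) = 0.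
  by apply/matrixP => i j; rewrite !mxE.
exact: mxpos0.
Qed.

Fact mos_posD m (x y : 'M[mos_elt]_m) :
  mos_pos x -> mos_pos y -> mos_pos (x + y).
Proof.
move=> x0 y0; have := mxposD x0 y0; rewrite /mos_pos; congr mxpos.
by apply/matrixP => i j; rewrite !mxE.
Qed.

Fact mos_posZ m (r : R) (x : 'M[mos_elt]_m) :
  0 <= r -> mos_pos x -> mos_pos (realscale r x).
Proof.
rewrite -lecR => r0 x0; have := mxposZ r0 x0; rewrite /mos_pos; congr mxpos.
by apply/matrixP => i j; rewrite !mxE.
Qed.

Fact mos_pos_proper m (x : 'M[mos_elt]_m) :
  mos_pos x -> mos_pos (- x) -> x = 0.
Proof.
move=> x0 xN; apply: mos_val_inj.
have -> : map_mx mos_val (0 : 'M[mos_elt]_m) = 0.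
  by apply/matrixP => i j; rewrite !mxE.
apply: mxpos_proper x0 _; move: xN; rewrite /mos_pos; congr mxpos.
by apply/matrixP => i j; rewrite !mxE.
Qed.

Fact mos_pos_compress p m (X : 'M[R[i]]_(p, m)) (x : 'M[mos_elt]_m) :
  mos_pos x -> mos_pos (mxcompress X x).
Proof.
move=> x0; have := mxpos_compress (map_mx (@scalar_mx _ k) X) x0.
rewrite /mos_pos; congr mxpos; apply/matrixP => i j; rewrite !mxE.
rewrite mos_val_sum; apply: eq_bigr => q _.
rewrite mos_val_sum; apply: eq_bigr => l _ /=.
by rewrite !mxE tr_scalar_mx map_scalar_mx mul_scalar_mx mul_mx_scalar scalerA
  mulrC.
Qed.

Fact mos_unit_selfadj : mos_adj mos_one = mos_one.
Proof. by apply: val_inj; rewrite /= trmx1 map_mx1. Qed.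

Fact mos_order_unit m (x : 'M[mos_elt]_m) : mxstar mos_adj x = x ->
  exists r : R, 0 < r /\ mos_pos (realscale r mos_one%:M + x).
Proof.
move=> /matrixP xsa; have [|r [r0 xr]] := @mxpos_order_unit R k m (map_mx val x).
  by move=> i j; rewrite !mxE -[in RHS]xsa !mxE.
by exists r; split => //; rewrite /mos_pos mos_val_shift.
Qed.

Fact mos_archimedean m (x : 'M[mos_elt]_m) :
  (forall r : R, 0 < r -> mos_pos (realscale r mos_one%:M + x)) -> mos_pos x.
Proof.
move=> xr; apply: mxpos_archimedean => r r0.
by rewrite -mos_val_shift; apply: xr.
Qed.

Definition mos_opSystem : opSystem R :=
  @OpSystem R mos_elt mos_adj mos_pos mos_one
    mos_star_semilinear mos_starK mos_pos_selfadj mos_pos0 mos_posD mos_posZ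
    mos_pos_proper mos_pos_compress mos_unit_selfadj mos_order_unit
    mos_archimedean.

End MatrixOperatorSystems.

(* D_n, with n.+1 for n: MathComp's algebras are nonzero. *)
Section DiagonalMatrices.
Variables (R : realType) (n : nat).
Local Notation C := R[i].

Definition diag_pred : {pred 'M[C]_n.+1} := fun a => is_diag_mx a.

Fact diag_pred_closed : GRing.subsemialg_closed diag_pred.
Proof.
split.
- exact: scalar_mx_is_diag.
- split; first exact: mx0_is_diag.
  move=> a b /is_diag_mxP a0 /is_diag_mxP b0; apply/is_diag_mxP => i j ij.
  by rewrite mxE a0 // b0 // addr0.
- move=> c a /is_diag_mxP a0; apply/is_diag_mxP => i j ij.
  by rewrite mxE a0 // mulr0.
- move=> a b /is_diag_mxP a0 /is_diag_mxP b0; apply/is_diag_mxP => i j ij.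
  rewrite mxE big1 // => l _; case: (eqVneq i l) => [<-|il].
    by rewrite b0 // mulr0.
  by rewrite a0 // mul0r.
Qed.
HB.instance Definition _ :=
  GRing.isSubalgClosed.Build C 'M[C]_n.+1 diag_pred diag_pred_closed.

Record diag_elt := DiagElt { diag_val :> 'M[C]_n.+1; _ : diag_val \in diag_pred }.

HB.instance Definition _ := [isSub for diag_val].
HB.instance Definition _ := [Choice of diag_elt by <:].
HB.instance Definition _ := [SubChoice_isSubAlgebra of diag_elt by <:].

Fact diag_star_subproof (a : diag_elt) : (val a)^t* \in diag_pred.
Proof.
have /is_diag_mxP a0 := valP a; apply/is_diag_mxP => i j ij.
by rewrite !mxE a0 ?conjC0 // eq_sym.
Qed.

Definition diag_star (a : diag_elt) : diag_elt := DiagElt (diag_star_subproof a).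

Fact diag_star_semilinear (c : C) (a b : diag_elt) :
  diag_star (c *: a + b) = Num.conj c *: diag_star a + diag_star b.
Proof.
by apply: val_inj; apply/matrixP => i j; rewrite !mxE rmorphD rmorphM.
Qed.

Fact diag_starM (a b : diag_elt) :
  diag_star (a * b) = diag_star b * diag_star a.
Proof. by apply: val_inj; rewrite /= trmx_mul map_mxM. Qed.

Fact diag_starK : involutive diag_star.
Proof. by move=> a; apply: val_inj; rewrite /= trmxCK. Qed.

Definition diagAlg : starAlg R :=
  @StarAlg R diag_elt diag_star diag_star_semilinear diag_starM diag_starK.

End DiagonalMatrices.

Record sgraph (n : nat) := SGraph {
  edge : rel 'I_n;
  edge_sym : symmetric edge;
  edge_irrefl : irreflexive edge
}.

Section GraphOperatorSystem.
Variables (R : realType) (n : nat) (G : sgraph n).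
Local Notation C := R[i].

Definition graph_set : {pred 'M[C]_n} := fun T =>
  [forall i, forall j, (T i j != 0) ==> (i == j) || edge G i j].

Lemma graph_setP (T : 'M[C]_n) :
  reflect (forall i j, T i j != 0 -> (i == j) || edge G i j) (T \in graph_set).
Proof.
apply: (iffP forallP) => T0 i; last by apply/forallP => j; apply/implyP/T0.
by move=> j; apply/implyP; have /forallP := T0 i.
Qed.

Fact graph_set_closed : GRing.subsemimod_closed graph_set.
Proof.
split; first split.
- by apply/graph_setP => i j; rewrite mxE eqxx.
- move=> S T /graph_setP S0 /graph_setP T0; apply/graph_setP => i j.
  apply: contraNT => ij; rewrite mxE.
  by rewrite (eqP (contraNT (S0 i j) ij)) (eqP (contraNT (T0 i j) ij)) addr0.
- move=> c T /graph_setP T0; apply/graph_setP => i j.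
  by apply: contraNT => ij; rewrite mxE (eqP (contraNT (T0 i j) ij)) mulr0.
Qed.
HB.instance Definition _ :=
  GRing.isSubmodClosed.Build C 'M[C]_n graph_set graph_set_closed.

Fact graph_set_unit : 1%:M \in graph_set.
Proof.
by apply/graph_setP => i j; rewrite mxE; case: (i == j); rewrite // eqxx.
Qed.

Fact graph_set_star (T : 'M[C]_n) : T \in graph_set -> T^t* \in graph_set.
Proof.
move=> /graph_setP T0; apply/graph_setP => i j.
by rewrite !mxE conjC_eq0 => /T0; rewrite eq_sym edge_sym.
Qed.

Definition graphOS : matrixOS R n :=
  @MatrixOS R n graph_set graph_set_unit graph_set_star.

Definition graph_opSystem : opSystem R := mos_opSystem graphOS.

End GraphOperatorSystem.

Section GraphBimodule.
Variables (R : realType) (n : nat) (G : sgraph n.+1).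
Local Notation S := (graph_opSystem R G).
Local Notation D := (diagAlg R n).

Lemma mul_diagE (a : D) (s : 'M_n.+1) i j :
  (val a *m s) i j = val a i i * s i j.
Proof.
have /is_diag_mxP a0 := valP a.
rewrite mxE (bigD1 i) //= big1 ?addr0 // => l li.
by rewrite a0 ?mul0r // eq_sym.
Qed.

Lemma mul_mx_diagE (a : D) (s : 'M_n.+1) i j :
  (s *m val a) i j = s i j * val a j j.
Proof.
have /is_diag_mxP a0 := valP a.
by rewrite mxE (bigD1 j) //= big1 ?addr0 // => l lj; rewrite a0 ?mulr0.
Qed.

Fact graph_lact_subproof (a : D) (s : S) : val a *m val s \in graph_set G.
Proof.
have /graph_setP s0 := valP s; apply/graph_setP => i j; rewrite mul_diagE.
by rewrite mulf_eq0 negb_or => /andP[_ /s0].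
Qed.

Fact graph_ract_subproof (s : S) (a : D) : val s *m val a \in graph_set G.
Proof.
have /graph_setP s0 := valP s; apply/graph_setP => i j; rewrite mul_mx_diagE.
by rewrite mulf_eq0 negb_or => /andP[/s0].
Qed.

Definition graph_lact (a : D) (s : S) : S :=
  @MosElt R n.+1 (graphOS R G) _ (graph_lact_subproof a s).

Definition graph_ract (s : S) (a : D) : S :=
  @MosElt R n.+1 (graphOS R G) _ (graph_ract_subproof s a).

Fact graph_lact_linearl (c : R[i]) (a b : D) (s : S) :
  graph_lact (c *: a + b) s = c *: graph_lact a s + graph_lact b s.
Proof. by apply: val_inj; rewrite /= mulmxDl scalemxAl. Qed.

Fact graph_lact_linearr (c : R[i]) (a : D) (s t : S) :
  graph_lact a (c *: s + t) = c *: graph_lact a s + graph_lact a t.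
Proof. by apply: val_inj; rewrite /= mulmxDr scalemxAr. Qed.

Fact graph_ract_linearl (c : R[i]) (a : D) (s t : S) :
  graph_ract (c *: s + t) a = c *: graph_ract s a + graph_ract t a.
Proof. by apply: val_inj; rewrite /= mulmxDl scalemxAl. Qed.

Fact graph_ract_linearr (c : R[i]) (a b : D) (s : S) :
  graph_ract s (c *: a + b) = c *: graph_ract s a + graph_ract s b.
Proof. by apply: val_inj; rewrite /= mulmxDr scalemxAr. Qed.

Fact graph_lact1 (s : S) : graph_lact 1 s = s.
Proof. by apply: val_inj; rewrite /= mul1mx. Qed.

Fact graph_ract1 (s : S) : graph_ract s 1 = s.
Proof. by apply: val_inj; rewrite /= mulmx1. Qed.

Fact graph_lactA (a b : D) (s : S) :
  graph_lact (a * b) s = graph_lact a (graph_lact b s).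
Proof. by apply: val_inj; rewrite /= mulmxA. Qed.

Fact graph_ractA (a b : D) (s : S) :
  graph_ract s (a * b) = graph_ract (graph_ract s a) b.
Proof. by apply: val_inj; rewrite /= mulmxA. Qed.

Fact graph_lractA (a b : D) (s : S) :
  graph_ract (graph_lact a s) b = graph_lact a (graph_ract s b).
Proof. by apply: val_inj; rewrite /= mulmxA. Qed.

Fact graph_star_lact (a : D) (s : S) :
  os_star (graph_lact a s) = graph_ract (os_star s) (sa_star a).
Proof. by apply: val_inj; rewrite /= trmx_mul map_mxM. Qed.

Fact graph_act_unit (a : D) :
  graph_lact a (os_unit S) = graph_ract (os_unit S) a.
Proof. by apply: val_inj; rewrite /= mulmx1 mul1mx. Qed.

Fact graph_act_pos p m (a : 'M[D]_(p, m)) (s : 'M[S]_m) : os_pos s ->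
  os_pos (\matrix_(i < p, j < p)
    \sum_k \sum_l graph_ract (graph_lact (a i k) (s k l)) (sa_star (a j l))).
Proof.
move=> s0; have := mxpos_compress (map_mx val a) s0.
rewrite /os_pos /= /mos_pos; congr mxpos; apply/matrixP => i j; rewrite !mxE.
rewrite mos_val_sum; apply: eq_bigr => q _.
rewrite mos_val_sum; apply: eq_bigr => l _ /=.
by rewrite !mxE.
Qed.

Definition graph_opASystem : opASystem D :=
  @OpASystem R D S graph_lact graph_ract
    graph_lact_linearl graph_lact_linearr graph_ract_linearl graph_ract_linearr
    graph_lact1 graph_ract1 graph_lactA graph_ractA graph_lractA
    graph_star_lact graph_act_unit graph_act_pos.

Lemma graph_opASystem_faithful : faithful graph_opASystem.
Proof.
move=> a a0 /(congr1 val); rewrite /= mulmx1 => a00.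
by move/eqP: a0; apply; apply: val_inj.
Qed.

End GraphBimodule.

(* Main.v *)
Require Import Defs.
From HB Require Import structures.
From mathcomp Require Import all_boot all_order all_algebra.
From mathcomp Require Import reals complex ring.

(** Both graphs are the complete graph on two vertices, so that the two
systems are copies of M_2 and the coproduct is M_2 + M_2 glued along the
diagonal.  Its C*-envelope is M_2(C(T)), T the unit circle: one copy of M_2 is
embedded as constants, the other has its (1,2) entry multiplied by the
coordinate function of T.  The proof uses the point evaluations of this
picture only, and not the C*-envelope.

Existence holds for all pairs of graphs.  The underlying space is the set of
pairs of matrices with a common diagonal, and a matrix over it is declared
positive when its image is positive under every map glued from a pair of
unital completely positive bimodule maps into a common target.  The universal
property and most of the axioms are then inherited from the targets.  What is
left is that the two embeddings reflect positivity and that the cones are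
proper.  Both follow from the conditional expectation onto the diagonal:
gluing the identity of one system with the expectation of the other gives a
ucp left inverse of the embedding ([glue_left], [glue_right]).

Now let f be a complete order isomorphism from a coproduct P onto an operator
system in M_k.  For |z| = 1 the identity of M_2 and the conjugation by a
diagonal unitary glue to a ucp map Psi_z : P -> M_2.  There is a sum of three
positive elements of M_2(P) that the functional X |-> <X w, w> after Psi_z
annihilates, w = e_1 (x) e_1 + e_2 (x) e_2 being the maximally entangled
vector ([witness_annihilated]).  So this sum is not bounded below by a
multiple of the unit, and neither is its image under f.  In finite dimension
a positive matrix not bounded below has a kernel vector ([psd_dichotomy]),
which all three summands must kill ([psd_kernelD]).  With the notation
e'_ij, e''_ij for the matrix units of the two copies and h = f(1), the three
kernel equations combine into the statement that conj z is an eigenvalue of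
  h^-1 f(e''_21) h^-1 f(e'_12),
a matrix that does not depend on z ([unimodular_eigenvalue]).  A k x k matrix
cannot have the whole circle as spectrum. *)

Set Implicit Arguments.
Unset Strict Implicit.
Unset Printing Implicit Defensive.

Import Order.TTheory GRing.Theory Num.Theory.
Local Open Scope ring_scope.

(** * Linear maps and actions on operator systems *)

Section LinearEntrywise.
Variables (R : realType) (U V : lmodType R[i]) (f : {linear U -> V}).

Lemma map_mx_realscale m (r : R) (x : 'M[U]_m) :
  map_mx f (realscale r x) = realscale r (map_mx f x).
Proof. by apply/matrixP => i j; rewrite !mxE linearZ. Qed.

Lemma map_mx_compress p m (X : 'M[R[i]]_(p, m)) (x : 'M[U]_m) :
  map_mx f (mxcompress X x) = mxcompress X (map_mx f x).
Proof.
apply/matrixP => i j; rewrite !mxE linear_sum; apply: eq_bigr => k _.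
by rewrite linear_sum; apply: eq_bigr => l _; rewrite linearZ !mxE.
Qed.

Lemma map_mx_shift m (r : R) (e : U) (x : 'M[U]_m) :
  map_mx f (realscale r e%:M + x) = realscale r (f e)%:M + map_mx f x.
Proof.
by apply/matrixP => i j; rewrite !mxE linearD linearZ /= linearMn.
Qed.

Lemma map_mx_diag m (e : U) : map_mx f (e%:M : 'M_m) = (f e)%:M.
Proof. by apply/matrixP => i j; rewrite !mxE linearMn. Qed.

End LinearEntrywise.

Section BimoduleMap.
Variables (R : realType) (A : starAlg R) (S T : opASystem A).
Variables (f : S -> T).
Hypothesis fM : bimodule_map f.

Lemma bimodule_lact a s : f (lact a s) = lact a (f s).
Proof. by rewrite -[lact a s]ract1 fM ract1. Qed.

Lemma ucp_id (U : opSystem R) : ucp (@idfun U).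
Proof. by split=> // m x; rewrite map_mx_id. Qed.

Lemma bimodule_id (U : opASystem A) : bimodule_map (@idfun U).
Proof. by []. Qed.

End BimoduleMap.

Section Actions.
Variables (R : realType) (A : starAlg R) (S : opASystem A).

Lemma lactD (a : A) (s t : S) : lact a (s + t) = lact a s + lact a t.
Proof. by have := lact_linearr 1 a s t; rewrite !scale1r. Qed.

Lemma ractD (a : A) (s t : S) : ract (s + t) a = ract s a + ract t a.
Proof. by have := ract_linearl 1 a s t; rewrite !scale1r. Qed.

End Actions.

Section OrderUnits.
Variables (R : realType).

Lemma os_pos_unit (S : opSystem R) m : os_pos ((os_unit S)%:M : 'M_m).
Proof.
have [|r [r0 x0]] := @os_order_unit R S m 0.
  apply/matrixP => i j; rewrite !mxE.
  have := os_star_semilinear (-1) (0 : S) 0.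
  by rewrite scaler0 addr0 rmorphN1 scaleN1r addNr.
have := os_posZ (ltW (_ : 0 < r^-1)) x0; rewrite invr_gt0 => /(_ r0).
congr os_pos; apply/matrixP => i j; rewrite !mxE addr0 scalerA -rmorphM.
by rewrite mulVf ?lt0r_neq0 // rmorph1 scale1r.
Qed.

(** The order unit axiom at - x, which is selfadjoint because x is. *)
Lemma os_unit_dominates (S : opSystem R) m (x : 'M[S]_m) : os_pos x ->
  exists r : R, 0 < r /\ os_pos (realscale r (os_unit S)%:M - x).
Proof.
move=> x0; apply: os_order_unit.
have nS (s : S) : os_star (- s) = - os_star s.
  have := os_star_semilinear (-1) s 0; rewrite addr0 rmorphN1 !scaleN1r => ->.
  have := os_star_semilinear (-1) (0 : S) 0.
  by rewrite scaler0 addr0 rmorphN1 scaleN1r addNr => ->; rewrite addr0.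
by rewrite -[in RHS](os_pos_selfadj x0); apply/matrixP => i j; rewrite !mxE nS.
Qed.

End OrderUnits.

(** * Entries and diagonal parts in graph operator systems *)

Section Entries.
Variables (R : realType) (n : nat).
Local Notation C := R[i].
Local Notation D := (diagAlg R n).

Definition dentry (a : D) i : C := diag_val a i i.

Lemma dentry_inj (a b : D) : dentry a =1 dentry b -> a = b.
Proof.
move=> ab; apply: val_inj; apply/matrixP => i j.
have /is_diag_mxP a0 := valP a; have /is_diag_mxP b0 := valP b.
by have [->|ij] := eqVneq i j; [apply: ab | rewrite a0 ?b0].
Qed.

Lemma dentryP (c : C) (a b : D) i :
  dentry (c *: a + b) i = c * dentry a i + dentry b i.
Proof. by rewrite /dentry !mxE. Qed.

Lemma dentryM (a b : D) i : dentry (a * b) i = dentry a i * dentry b i.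
Proof. exact: mul_diagE. Qed.

Lemma dentry_star (a : D) i : dentry (sa_star a) i = Num.conj (dentry a i).
Proof. by rewrite /dentry !mxE. Qed.

Variable G : sgraph n.+1.
Local Notation S := (graph_opASystem R G).

Definition entry (s : S) i j : C := mos_val s i j.

Lemma entry_inj (s t : S) : (forall i j, entry s i j = entry t i j) -> s = t.
Proof. by move=> st; apply: val_inj; apply/matrixP. Qed.

Lemma entry_edge (s : S) i j : entry s i j != 0 -> (i == j) || edge G i j.
Proof. by have /graph_setP := valP s; apply. Qed.

Lemma entryP (c : C) (s t : S) i j :
  entry (c *: s + t) i j = c * entry s i j + entry t i j.
Proof. by rewrite /entry !mxE. Qed.

Lemma entryD (s t : S) i j : entry (s + t) i j = entry s i j + entry t i j.
Proof. by rewrite /entry !mxE. Qed.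

Lemma entry_lact (a : D) (s : S) i j :
  entry (lact a s) i j = dentry a i * entry s i j.
Proof. exact: mul_diagE. Qed.

Lemma entry_ract (a : D) (s : S) i j :
  entry (ract s a) i j = entry s i j * dentry a j.
Proof. exact: mul_mx_diagE. Qed.

Lemma entry_star (s : S) i j : entry (os_star s) i j = Num.conj (entry s j i).
Proof. by rewrite /entry !mxE. Qed.

Lemma entry_unit i j : entry (os_unit S) i j = (i == j)%:R.
Proof. by rewrite /entry mxE. Qed.

Definition entries m (x : 'M[S]_m) (p q : 'I_m * 'I_n.+1) : C :=
  entry (x p.1 q.1) p.2 q.2.

Lemma graph_posP m (x : 'M[S]_m) :
  os_pos x <-> forall v, 0 <= sform (entries x) v v.
Proof.
have E v : sform (entries x) v v =
    sform (flatmx (map_mx (@mos_val R n.+1 (graphOS R G)) x)) v v.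
  apply: eq_bigr => p _; apply: eq_bigr => q _.
  by rewrite /flatmx /entries mxE.
split=> [/mxposP x0 v | x0]; first by rewrite E.
by apply/mxposP => v; rewrite -E.
Qed.

End Entries.

Arguments entry : simpl never.
Arguments dentry : simpl never.

Section DiagonalPart.
Variables (R : realType) (n : nat) (G : sgraph n.+1).
Local Notation C := R[i].
Local Notation S := (graph_opASystem R G).
Local Notation D := (diagAlg R n).

Lemma diag_partP (s : S) :
  \matrix_(i, j) (entry s i j *+ (i == j)) \in @diag_pred R n.
Proof. by apply/is_diag_mxP => i j /negPf ij; rewrite mxE -val_eqE ij. Qed.

Definition diag_part (s : S) : D := DiagElt (diag_partP s).

Lemma diag_partE s i : dentry (diag_part s) i = entry s i i.
Proof. by rewrite /dentry mxE eqxx. Qed.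

Fact diag_part_linear : linear diag_part.
Proof.
by move=> c s t; apply: dentry_inj => i; rewrite dentryP !diag_partE entryP.
Qed.
HB.instance Definition _ := GRing.isLinear.Build C S D _ diag_part
  diag_part_linear.

Lemma offdiag_partP (s : S) :
  \matrix_(i, j) (entry s i j *+ (i != j)) \in graph_set G.
Proof.
apply/graph_setP => i j; rewrite mxE.
by have := @entry_edge _ _ _ s i j; case: (i == j).
Qed.

Definition offdiag_part (s : S) : S :=
  @MosElt R n.+1 (graphOS R G) _ (offdiag_partP s).

Lemma offdiag_partE (s : S) i j :
  entry (offdiag_part s) i j = entry s i j *+ (i != j).
Proof. by rewrite [LHS]mxE. Qed.

Fact offdiag_part_linear : linear offdiag_part.
Proof.
move=> c s t; apply: entry_inj => i j; rewrite entryP !offdiag_partE entryP.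
by case: (i == j); rewrite // !mulr0n mulr0 addr0.
Qed.
HB.instance Definition _ := GRing.isLinear.Build C S S _ offdiag_part
  offdiag_part_linear.

Lemma offdiag_unit : offdiag_part (os_unit S) = 0.
Proof.
apply: entry_inj => i j; rewrite offdiag_partE entry_unit.
by rewrite [RHS]mxE; case: (i == j).
Qed.

Lemma diag_offdiag s : lact (diag_part s) (os_unit S) + offdiag_part s = s.
Proof.
apply: entry_inj => i j.
rewrite entryD entry_lact entry_unit offdiag_partE diag_partE.
by case: eqP => [->|_]; rewrite ?mulr1 ?addr0 ?mulr0 ?add0r.
Qed.

Lemma diag_part_act (a b : D) (s : S) :
  diag_part (ract (lact a s) b) = a * diag_part s * b.
Proof.
apply: dentry_inj => i.
by rewrite !dentryM !diag_partE entry_ract entry_lact.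
Qed.

Lemma offdiag_part_act (a b : D) (s : S) :
  offdiag_part (ract (lact a s) b) = ract (lact a (offdiag_part s)) b.
Proof.
apply: entry_inj => i j.
rewrite entry_ract entry_lact !offdiag_partE entry_ract entry_lact.
by case: (i == j); rewrite // !mulr0n mulr0 mul0r.
Qed.

End DiagonalPart.

Section Expectation.
Variables (R : realType) (n : nat) (G H : sgraph n.+1).
Local Notation C := R[i].
Local Notation S := (graph_opASystem R G).
Local Notation T := (graph_opASystem R H).
Local Notation D := (diagAlg R n).

(** The expectation is allowed to change the graph: every graph operator system
over D contains D. *)
Definition expectation (s : S) : T := lact (diag_part s) (os_unit T).

Fact expectation_linear : linear expectation.
Proof. by move=> c s t; rewrite /expectation linearP lact_linearl. Qed.
HB.instance Definition _ := GRing.isLinear.Build C S T _ expectation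
  expectation_linear.

Lemma expectationE s i j : entry (expectation s) i j = entry s i j *+ (i == j).
Proof.
rewrite entry_lact entry_unit diag_partE.
by case: eqP => [->|_]; rewrite ?mulr1 ?mulr0.
Qed.

Lemma expectation_offdiag (s : S) :
  expectation (offdiag_part s) = 0.
Proof.
apply: entry_inj => i j; rewrite expectationE offdiag_partE [RHS]mxE.
by case: (i == j).
Qed.

Lemma offdiag_expectation (s : S) :
  offdiag_part (expectation s) = 0.
Proof.
apply: entry_inj => i j; rewrite offdiag_partE expectationE [RHS]mxE.
by case: (i == j).
Qed.

Lemma expectation_bimodule : bimodule_map expectation.
Proof.
move=> a b s; apply: entry_inj => i j.
rewrite entry_ract [in RHS]entry_lact !expectationE entry_ract entry_lact.
by case: (i == j); rewrite // !mulr0n mulr0 mul0r.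
Qed.

(** The form of the compressed matrix at v is the sum over the basis vectors e_a
of C^n of the form of x at the component of v along e_a, because the
expectation is s |-> \sum_a e_aa s e_aa. *)
Lemma expectation_ucp : ucp expectation.
Proof.
split.
  apply: entry_inj => i j; rewrite expectationE !entry_unit.
  by case: (i == j).
move=> m x /graph_posP x0; apply/graph_posP => v.
pose w a (p : 'I_m * 'I_n.+1) := v p *+ (p.2 == a).
suff -> : sform (entries (map_mx expectation x)) v v =
    \sum_a sform (entries x) (w a) (w a).
  by apply: sumr_ge0 => a _; apply: x0.
rewrite /sform [RHS]exchange_big /=; apply: eq_bigr => p _.
rewrite [RHS]exchange_big /=; apply: eq_bigr => q _.
rewrite (bigD1 p.2) //= [X in _ + X]big1 ?addr0 => [|a /negPf ap].
  rewrite /w /entries mxE expectationE eqxx [q.2 == _]eq_sym.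
  by case: (_ == _); rewrite // !mulr0n mulr0 mul0r mulr0.
by rewrite /w [p.2 == a]eq_sym ap mulr0n conjC0 !mul0r.
Qed.

End Expectation.

(** * The coproduct of two graph operator systems *)

Section Coproduct.
Variables (R : realType) (n : nat) (G1 G2 : sgraph n.+1).
Local Notation C := R[i].
Local Notation S1 := (graph_opASystem R G1).
Local Notation S2 := (graph_opASystem R G2).
Local Notation D := (diagAlg R n).

(** The quotient of S1 * S2 by the copies of D, realized as a subspace: the pair
(s, t) stands for phi1 s + phi2 (offdiagonal part of t). *)
Definition cop_pred : {pred S1 * S2} :=
  fun x => diag_part x.1 == diag_part x.2.

Fact cop_pred_closed : GRing.subsemimod_closed cop_pred.
Proof.
split; first split.
- by rewrite /in_mem /= /cop_pred !linear0.
- by move=> x y /eqP xE /eqP yE; apply/eqP; rewrite !linearD /= xE yE.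
- by move=> c x /eqP xE; apply/eqP; rewrite !linearZ /= xE.
Qed.
HB.instance Definition _ :=
  GRing.isSubmodClosed.Build C (S1 * S2)%type cop_pred cop_pred_closed.

Record cop_elt := CopElt { cop_val :> S1 * S2; _ : cop_val \in cop_pred }.

HB.instance Definition _ := [isSub for cop_val].
HB.instance Definition _ := [Choice of cop_elt by <:].
HB.instance Definition _ := [SubChoice_isSubLmodule of cop_elt by <:].

Definition left_part (x : cop_elt) : S1 := (cop_val x).1.
Definition right_part (x : cop_elt) : S2 := (cop_val x).2.

Lemma cop_eqP x y :
  left_part x = left_part y -> right_part x = right_part y -> x = y.
Proof.
move=> l r; apply: val_inj; apply/eqP; rewrite -pair_eqE.
by apply/andP; split; apply/eqP.
Qed.

Fact left_part_linear : linear left_part.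
Proof. by []. Qed.
HB.instance Definition _ := GRing.isLinear.Build C cop_elt S1 _ left_part
  left_part_linear.

Fact right_part_linear : linear right_part.
Proof. by []. Qed.
HB.instance Definition _ := GRing.isLinear.Build C cop_elt S2 _ right_part
  right_part_linear.

Lemma cop_diag x : diag_part (left_part x) = diag_part (right_part x).
Proof. by apply/eqP; case: x. Qed.

Definition cop_mk s t (e : diag_part s = diag_part t) : cop_elt :=
  @CopElt (s, t) (introT eqP e).

Fact cop_star_subproof (x : cop_elt) :
  diag_part (os_star (left_part x)) = diag_part (os_star (right_part x)).
Proof.
apply: dentry_inj => i; rewrite !diag_partE !entry_star.
by rewrite -!diag_partE cop_diag.
Qed.
Definition cop_star x := cop_mk (cop_star_subproof x).

Fact cop_act_subproof (a b : D) (x : cop_elt) :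
  diag_part (ract (lact a (left_part x)) b) =
  diag_part (ract (lact a (right_part x)) b).
Proof. by rewrite !diag_part_act cop_diag. Qed.

Fact cop_lact_subproof (a : D) (x : cop_elt) :
  diag_part (lact a (left_part x)) = diag_part (lact a (right_part x)).
Proof. by have := cop_act_subproof a 1 x; rewrite !ract1. Qed.
Definition cop_lact a x := cop_mk (cop_lact_subproof a x).

Fact cop_ract_subproof (x : cop_elt) (a : D) :
  diag_part (ract (left_part x) a) = diag_part (ract (right_part x) a).
Proof. by have := cop_act_subproof 1 a x; rewrite !lact1. Qed.
Definition cop_ract x a := cop_mk (cop_ract_subproof x a).

Fact cop_inl_subproof (s : S1) :
  diag_part s = diag_part (expectation G2 s).
Proof. by apply: dentry_inj => i; rewrite !diag_partE expectationE eqxx. Qed.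
Definition cop_inl s := cop_mk (cop_inl_subproof s).

Fact cop_inr_subproof (s : S2) :
  diag_part (expectation G1 s) = diag_part s.
Proof. by apply: dentry_inj => i; rewrite !diag_partE expectationE eqxx. Qed.
Definition cop_inr s := cop_mk (cop_inr_subproof s).

Fact cop_unit_subproof : diag_part (os_unit S1) = diag_part (os_unit S2).
Proof. by apply: dentry_inj => i; rewrite !diag_partE !entry_unit. Qed.
Definition cop_unit := cop_mk cop_unit_subproof.

Fact cop_inl_linear : linear cop_inl.
Proof.
by move=> c s t; apply: cop_eqP; rewrite linearP //= /right_part /= linearP.
Qed.
HB.instance Definition _ := GRing.isLinear.Build C S1 cop_elt _ cop_inl
  cop_inl_linear.

Fact cop_inr_linear : linear cop_inr.
Proof.
by move=> c s t; apply: cop_eqP; rewrite linearP //= /left_part /= linearP.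
Qed.
HB.instance Definition _ := GRing.isLinear.Build C S2 cop_elt _ cop_inr
  cop_inr_linear.

Lemma cop_split x :
  x = cop_inl (left_part x) + cop_inr (offdiag_part (right_part x)).
Proof.
apply: cop_eqP.
  by rewrite linearD /= [X in _ + X]expectation_offdiag addr0.
by rewrite linearD /= [X in X + _]/(expectation _ _) /expectation cop_diag
  diag_offdiag.
Qed.

Section Glue.
Variables (Q : opASystem D) (psi1 : {linear S1 -> Q}) (psi2 : {linear S2 -> Q}).

(** The map induced on the coproduct by psi1 and psi2.  The common diagonal of
a pair is counted once, through psi1; unital bimodule maps agree on it. *)
Definition glue (x : cop_elt) : Q :=
  psi1 (left_part x) + psi2 (offdiag_part (right_part x)).

Fact glue_linear : linear glue.
Proof.
by move=> c x y; rewrite /glue !linearP addrACA -scalerDr.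
Qed.
HB.instance Definition _ := GRing.isLinear.Build C cop_elt Q _ glue glue_linear.

Hypotheses (psi1_ucp : ucp psi1) (psi1_bim : bimodule_map psi1).
Hypotheses (psi2_ucp : ucp psi2) (psi2_bim : bimodule_map psi2).

Lemma glue_unit : glue cop_unit = os_unit Q.
Proof.
by rewrite /glue /right_part offdiag_unit linear0 addr0; case: psi1_ucp.
Qed.

Lemma glue_act a b x :
  glue (cop_ract (cop_lact a x) b) = ract (lact a (glue x)) b.
Proof.
rewrite /glue /left_part /right_part /= offdiag_part_act psi1_bim psi2_bim.
by rewrite lactD ractD.
Qed.

Lemma glue_inl s : glue (cop_inl s) = psi1 s.
Proof.
by rewrite /glue offdiag_expectation linear0 addr0.
Qed.

Lemma glue_inr s : glue (cop_inr s) = psi2 s.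
Proof.
rewrite /glue /= -[in RHS](diag_offdiag s) linearD; congr (_ + _).
rewrite [LHS](bimodule_lact psi1_bim) (bimodule_lact psi2_bim).
by case: psi1_ucp psi2_ucp => -> _ [-> _].
Qed.

End Glue.

(** The largest matrix order for which all glued maps are positive; quantifying
over all targets at once makes the universal property hold by definition. *)
Definition cop_pos m (x : 'M[cop_elt]_m) : Prop :=
  forall (Q : opASystem D) (psi1 : {linear S1 -> Q}) (psi2 : {linear S2 -> Q}),
    ucp psi1 -> bimodule_map psi1 -> ucp psi2 -> bimodule_map psi2 ->
    os_pos (map_mx (glue psi1 psi2) x).

Lemma glue_left x : glue idfun (@expectation R n G2 G1) x = left_part x.
Proof.
by rewrite /glue /= expectation_offdiag addr0.
Qed.

Lemma glue_right x : glue (@expectation R n G1 G2) idfun x = right_part x.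
Proof.
by rewrite /glue /= /expectation cop_diag diag_offdiag.
Qed.

(** The glued maps of [glue_left] and [glue_right] are the two coordinates, so
positivity in the coproduct implies positivity in both; this separates points
and makes the embeddings order reflecting. *)
Lemma cop_pos_left m (x : 'M[cop_elt]_m) :
  cop_pos x -> os_pos (map_mx left_part x).
Proof.
move=> /(_ S1 idfun (@expectation R n G2 G1)).
rewrite (eq_map_mx _ glue_left); apply.
- exact: ucp_id.
- exact: bimodule_id.
- exact: expectation_ucp.
- exact: expectation_bimodule.
Qed.

Lemma cop_pos_right m (x : 'M[cop_elt]_m) :
  cop_pos x -> os_pos (map_mx right_part x).
Proof.
move=> /(_ S2 (@expectation R n G1 G2) idfun).
rewrite (eq_map_mx _ glue_right); apply.
- exact: expectation_ucp.
- exact: expectation_bimodule.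
- exact: ucp_id.
- exact: bimodule_id.
Qed.

Lemma cop_mx_eqP m (x y : 'M[cop_elt]_m) :
  map_mx left_part x = map_mx left_part y ->
  map_mx right_part x = map_mx right_part y -> x = y.
Proof.
move=> /matrixP l /matrixP r; apply/matrixP => i j; apply: cop_eqP.
  by have := l i j; rewrite !mxE.
by have := r i j; rewrite !mxE.
Qed.

Fact cop_star_semilinear (c : C) (x y : cop_elt) :
  cop_star (c *: x + y) = Num.conj c *: cop_star x + cop_star y.
Proof. by apply: cop_eqP; apply: os_star_semilinear. Qed.

Fact cop_starK : involutive cop_star.
Proof. by move=> x; apply: cop_eqP; apply: os_starK. Qed.

Lemma map_left_star m (x : 'M[cop_elt]_m) :
  map_mx left_part (mxstar cop_star x) =
  mxstar (@os_star _ S1) (map_mx left_part x).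
Proof. by apply/matrixP => i j; rewrite !mxE. Qed.

Lemma map_right_star m (x : 'M[cop_elt]_m) :
  map_mx right_part (mxstar cop_star x) =
  mxstar (@os_star _ S2) (map_mx right_part x).
Proof. by apply/matrixP => i j; rewrite !mxE. Qed.

Fact cop_pos_selfadj m (x : 'M[cop_elt]_m) : cop_pos x -> mxstar cop_star x = x.
Proof.
move=> x0; apply: cop_mx_eqP.
  by rewrite map_left_star (os_pos_selfadj (cop_pos_left x0)).
by rewrite map_right_star (os_pos_selfadj (cop_pos_right x0)).
Qed.

Fact cop_pos0 m : cop_pos (0 : 'M[cop_elt]_m).
Proof. by move=> Q psi1 psi2 _ _ _ _; rewrite map_mx0; apply: os_pos0. Qed.

Fact cop_posD m (x y : 'M[cop_elt]_m) :
  cop_pos x -> cop_pos y -> cop_pos (x + y).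
Proof.
move=> x0 y0 Q psi1 psi2 u1 b1 u2 b2; rewrite map_mxD.
by apply: os_posD; [apply: x0 | apply: y0].
Qed.

Fact cop_posZ m (r : R) (x : 'M[cop_elt]_m) :
  0 <= r -> cop_pos x -> cop_pos (realscale r x).
Proof.
move=> r0 x0 Q psi1 psi2 u1 b1 u2 b2; rewrite map_mx_realscale.
by apply: os_posZ => //; apply: x0.
Qed.

Fact cop_pos_proper m (x : 'M[cop_elt]_m) :
  cop_pos x -> cop_pos (- x) -> x = 0.
Proof.
move=> x0 xN; apply: cop_mx_eqP; rewrite map_mx0.
  apply: os_pos_proper (cop_pos_left x0) _.
  by rewrite -map_mxN; apply: cop_pos_left.
apply: os_pos_proper (cop_pos_right x0) _.
by rewrite -map_mxN; apply: cop_pos_right.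
Qed.

Fact cop_pos_compress p m (X : 'M[C]_(p, m)) (x : 'M[cop_elt]_m) :
  cop_pos x -> cop_pos (mxcompress X x).
Proof.
move=> x0 Q psi1 psi2 u1 b1 u2 b2; rewrite map_mx_compress.
by apply: os_pos_compress; apply: x0.
Qed.

Fact cop_unit_selfadj : cop_star cop_unit = cop_unit.
Proof. by apply: cop_eqP; apply: os_unit_selfadj. Qed.

(** Every glued map is a sum of a ucp map of the left part and a ucp map of the
offdiagonal right part, so the order unit constants of S1 and S2 add up to one
that serves all targets. *)
Fact cop_order_unit m (x : 'M[cop_elt]_m) : mxstar cop_star x = x ->
  exists r : R, 0 < r /\ cop_pos (realscale r cop_unit%:M + x).
Proof.
move=> xsa.
have [r1 [r1_gt0 x1]] : exists r : R, 0 < r /\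
    os_pos (realscale r (os_unit S1)%:M + map_mx left_part x).
  by apply: os_order_unit; rewrite -map_left_star xsa.
have [r2 [r2_gt0 x2]] : exists r : R, 0 < r /\ os_pos (realscale r
    (os_unit S2)%:M + map_mx (@offdiag_part R n G2) (map_mx right_part x)).
  apply: os_order_unit; rewrite -[in RHS]xsa map_right_star.
  apply/matrixP => i j; rewrite !mxE; apply: entry_inj => a b.
  rewrite entry_star !offdiag_partE entry_star eq_sym.
  by case: (_ == _); rewrite // mulr0n conjC0.
exists (r1 + r2); split=> [|Q psi1 psi2 u1 b1 u2 b2]; first exact: addr_gt0.
have [psi1_1 psi1_cp] := u1; have [psi2_1 psi2_cp] := u2.
rewrite map_mx_shift /= glue_unit //.
have := os_posD (psi1_cp _ _ x1) (psi2_cp _ _ x2).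
rewrite !map_mx_shift psi1_1 psi2_1; congr os_pos.
apply/matrixP => i j; rewrite !mxE /glue rmorphD scalerDl /=.
by rewrite addrACA.
Qed.

Fact cop_archimedean m (x : 'M[cop_elt]_m) :
  (forall r : R, 0 < r -> cop_pos (realscale r cop_unit%:M + x)) -> cop_pos x.
Proof.
move=> xr Q psi1 psi2 u1 b1 u2 b2; apply: os_archimedean => r r0.
have := xr r r0 Q psi1 psi2 u1 b1 u2 b2.
by rewrite map_mx_shift /= glue_unit.
Qed.

Definition cop_opSystem : opSystem R :=
  @OpSystem R cop_elt cop_star cop_pos cop_unit
    cop_star_semilinear cop_starK cop_pos_selfadj cop_pos0 cop_posD cop_posZ
    cop_pos_proper cop_pos_compress cop_unit_selfadj cop_order_unit
    cop_archimedean.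

Fact cop_act_pos p m (a : 'M[D]_(p, m)) (x : 'M[cop_elt]_m) : cop_pos x ->
  cop_pos (\matrix_(i < p, j < p)
    \sum_k \sum_l cop_ract (cop_lact (a i k) (x k l)) (sa_star (a j l))).
Proof.
move=> x0 Q psi1 psi2 u1 b1 u2 b2.
have := act_pos a (x0 Q psi1 psi2 u1 b1 u2 b2).
congr os_pos; apply/matrixP => i j; rewrite !mxE linear_sum.
apply: eq_bigr => k _; rewrite linear_sum; apply: eq_bigr => l _.
by rewrite [RHS]glue_act // mxE.
Qed.

Fact cop_lact_linearl (c : C) (a b : D) (x : cop_elt) :
  cop_lact (c *: a + b) x = c *: cop_lact a x + cop_lact b x.
Proof. by apply: cop_eqP; apply: lact_linearl. Qed.

Fact cop_lact_linearr (c : C) (a : D) (x y : cop_elt) :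
  cop_lact a (c *: x + y) = c *: cop_lact a x + cop_lact a y.
Proof. by apply: cop_eqP; apply: lact_linearr. Qed.

Fact cop_ract_linearl (c : C) (a : D) (x y : cop_elt) :
  cop_ract (c *: x + y) a = c *: cop_ract x a + cop_ract y a.
Proof. by apply: cop_eqP; apply: ract_linearl. Qed.

Fact cop_ract_linearr (c : C) (a b : D) (x : cop_elt) :
  cop_ract x (c *: a + b) = c *: cop_ract x a + cop_ract x b.
Proof. by apply: cop_eqP; apply: ract_linearr. Qed.

Fact cop_lact1 (x : cop_elt) :
  cop_lact 1 x = x.
Proof. by apply: cop_eqP; apply: lact1. Qed.

Fact cop_ract1 (x : cop_elt) :
  cop_ract x 1 = x.
Proof. by apply: cop_eqP; apply: ract1. Qed.

Fact cop_lactA (a b : D) (x : cop_elt) :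
  cop_lact (a * b) x = cop_lact a (cop_lact b x).
Proof. by apply: cop_eqP; apply: lactA. Qed.

Fact cop_ractA (a b : D) (x : cop_elt) :
  cop_ract x (a * b) = cop_ract (cop_ract x a) b.
Proof. by apply: cop_eqP; apply: ractA. Qed.

Fact cop_lractA (a b : D) (x : cop_elt) :
  cop_ract (cop_lact a x) b = cop_lact a (cop_ract x b).
Proof. by apply: cop_eqP; apply: lractA. Qed.

Fact cop_star_lact (a : D) (x : cop_elt) :
  cop_star (cop_lact a x) = cop_ract (cop_star x) (sa_star a).
Proof. by apply: cop_eqP; apply: star_lact. Qed.

Fact cop_act_unit (a : D) :
  cop_lact a cop_unit = cop_ract cop_unit a.
Proof. by apply: cop_eqP; apply: act_unit. Qed.

Definition cop_opASystem : opASystem D :=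
  @OpASystem R D cop_opSystem cop_lact cop_ract
    cop_lact_linearl cop_lact_linearr cop_ract_linearl cop_ract_linearr
    cop_lact1 cop_ract1 cop_lactA cop_ractA cop_lractA
    cop_star_lact cop_act_unit cop_act_pos.

Theorem graph_coproduct_exists :
  @is_coproduct R D S1 S2 cop_opASystem cop_inl cop_inr.
Proof.
split.
- move=> a a0 /(congr1 left_part); apply: graph_opASystem_faithful a0.
- split.
  + by apply: cop_eqP => //; case: (@expectation_ucp R n G1 G2).
  + split=> [s t /(congr1 left_part) //|m x]; split=> [x0|].
      move=> Q psi1 psi2 u1 b1 u2 b2; rewrite -map_mx_comp.
      rewrite (eq_map_mx _ (glue_inl psi1 psi2)).
      by case: u1 => _; apply.
    by move/cop_pos_left; rewrite -map_mx_comp map_mx_id.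
  + by move=> a b s; apply: cop_eqP => //; apply: expectation_bimodule.
- split.
  + by apply: cop_eqP => //; case: (@expectation_ucp R n G2 G1).
  + split=> [s t /(congr1 right_part) //|m x]; split=> [x0|].
      move=> Q psi1 psi2 u1 b1 u2 b2; rewrite -map_mx_comp.
      rewrite (eq_map_mx _ (glue_inr u1 b1 u2 b2)).
      by case: u2 => _; apply.
    by move/cop_pos_right; rewrite -map_mx_comp map_mx_id.
  + by move=> a b s; apply: cop_eqP => //; apply: expectation_bimodule.
- move=> Q psi1 psi2 u1 b1 u2 b2.
  exists (glue psi1 psi2 : {linear cop_opASystem -> Q}).
    split.
    + by split=> [|m x x0]; [apply: glue_unit | apply: x0].
    + by move=> a b x; apply: glue_act.
    + exact: glue_inl.
    + exact: glue_inr.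
  move=> Psi [_ _ Psi1 Psi2] x.
  by rewrite [x in LHS]cop_split linearD Psi1 Psi2.
Qed.

End Coproduct.

(** * Kernels of positive semidefinite forms *)

Section PositiveForms.
Variables (C : numClosedFieldType) (T : finType).
Implicit Types (F : T -> T -> C) (u v w : T -> C).

Definition fapply F v p := \sum_q F p q * v q.
Definition normsq v := \sum_p `|v p| ^+ 2.

Lemma normsq_ge0 v : 0 <= normsq v.
Proof. by apply: sumr_ge0 => p _; apply: exprn_ge0. Qed.

Lemma normsq_eq0 v : normsq v <= 0 -> v =1 (fun=> 0).
Proof.
move=> v0 p; apply/eqP; rewrite -normr_eq0 -sqrf_eq0; apply/eqP/le_anti.
rewrite exprn_ge0 // andbT; apply: le_trans v0.
rewrite /normsq (bigD1 p) //= lerDl; apply: sumr_ge0 => q _.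
exact: exprn_ge0.
Qed.

Lemma sformE F u v : sform F u v = \sum_p Num.conj (u p) * fapply F v p.
Proof.
apply: eq_bigr => p _; rewrite mulr_sumr; apply: eq_bigr => q _.
by rewrite mulrA.
Qed.

Lemma sform_fapply F u : sform F (fapply F u) u = normsq (fapply F u).
Proof.
by rewrite sformE; apply: eq_bigr => p _; rewrite normCK mulrC.
Qed.

Definition fbound F := \sum_p \sum_q (`|F p q| *+ 2) + 1.

Lemma fbound_gt0 F : 0 < fbound F.
Proof.
apply: ltr_wpDl => //; apply: sumr_ge0 => p _; apply: sumr_ge0 => q _.
by rewrite mulrn_wge0.
Qed.

Lemma sform_fbound F v : `|sform F v v| <= fbound F * normsq v.
Proof.
apply: le_trans (sform_bound F v) _.
by rewrite mulrDl mul1r lerDl normsq_ge0.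
Qed.

(** |F v|^2 is the form of F^* F at v. *)
Lemma fapply_bound F :
  exists2 c, 0 < c & forall v, normsq (fapply F v) <= c * normsq v.
Proof.
pose H p q := \sum_r Num.conj (F r p) * F r q.
have HE v : sform H v v = normsq (fapply F v).
  transitivity (\sum_r Num.conj (fapply F v r) * fapply F v r); last first.
    by apply: eq_bigr => r _; rewrite normCK mulrC.
  rewrite /sform; under eq_bigr do under eq_bigr do
    rewrite mulr_sumr mulr_suml.
  under eq_bigr do rewrite exchange_big /=.
  rewrite exchange_big /=; apply: eq_bigr => r _.
  rewrite rmorph_sum mulr_suml; apply: eq_bigr => p _.
  rewrite mulr_sumr; apply: eq_bigr => q _; rewrite rmorphM /=; ring.
exists (fbound H) => [|v]; first exact: fbound_gt0.
apply: le_trans (sform_fbound H v).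
by rewrite HE ger0_norm ?normsq_ge0.
Qed.

(** Expand 0 <= [v - t F v, v - t F v] for the form of F: both mixed terms are
t |F v|^2, and the last term is at most t^2 c |F v|^2 with c = [fbound F].
The choice t = c^-1 gives the claim. *)
Lemma psd_fapply F v : (forall v, 0 <= sform F v v) ->
  normsq (fapply F v) <= fbound F * sform F v v.
Proof.
move=> F0; set c := fbound F; set u := fapply F v; set N := normsq u.
have c0 : 0 < c := fbound_gt0 F.
have cr : Num.conj c^-1 = c^-1 by apply/CrealP; rewrite gtr0_real ?invr_gt0.
have := F0 (fun p => v p + (- c^-1) * u p).
rewrite sformDl !sformDr.
have sl x w : sform F (fun p => (- c^-1) * x p) w = (- c^-1) * sform F x w.
  rewrite !sformE mulr_sumr; apply: eq_bigr => p _.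
  by rewrite rmorphM rmorphN /= cr mulrA.
have sr x w : sform F x (fun p => (- c^-1) * w p) = (- c^-1) * sform F x w.
  rewrite /sform mulr_sumr; apply: eq_bigr => p _.
  by rewrite mulr_sumr; apply: eq_bigr => q _; rewrite mulrCA.
have Nu : sform F u v = N := sform_fapply F v.
have Nv : sform F v u = N.
  have -> : N = Num.conj N.
    by apply/esym/CrealP; rewrite ger0_real ?normsq_ge0.
  rewrite -Nu /sform rmorph_sum /= exchange_big /=; apply: eq_bigr => p _.
  rewrite rmorph_sum /=; apply: eq_bigr => q _.
  rewrite !rmorphM /= conjCK -(sform_herm F0); ring.
rewrite !sl !sr Nu Nv.
have B : c^-1 * (c^-1 * sform F u u) <= c^-1 * N.
  rewrite ler_pM2l ?invr_gt0 // -ler_pdivlMl ?invr_gt0 // invrK.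
  apply: le_trans (sform_fbound F u); apply: real_ler_norm.
  by rewrite ger0_real.
move=> H; rewrite -ler_pdivrMl //.
rewrite -subr_ge0; apply: le_trans H _; rewrite -subr_ge0.
set S := sform F v v; set U := sform F u u in B *.
suff -> : S - c^-1 * N - (S + - c^-1 * N + (- c^-1 * N + - c^-1 * (- c^-1 * U)))
    = c^-1 * N - c^-1 * (c^-1 * U) by rewrite subr_ge0.
ring.
Qed.

Lemma psd_kernel F v : (forall v, 0 <= sform F v v) -> sform F v v <= 0 ->
  fapply F v =1 (fun=> 0).
Proof.
move=> F0 v0; apply: normsq_eq0; apply: le_trans (psd_fapply v F0) _.
by rewrite pmulr_rle0 // fbound_gt0.
Qed.

(** The two forms are nonnegative at v and add up to 0, so each vanishes at v;
for a positive form this means that v is in the kernel. *)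
Lemma psd_kernelD F G v : (forall v, 0 <= sform F v v) ->
  (forall v, 0 <= sform G v v) ->
  fapply (fun p q => F p q + G p q) v =1 (fun=> 0) ->
  fapply F v =1 (fun=> 0) /\ fapply G v =1 (fun=> 0).
Proof.
move=> F0 G0 FG.
have E : sform F v v + sform G v v = 0.
  rewrite !sformE -big_split big1 //= => p _; rewrite -mulrDr.
  rewrite -[X in _ * X](_ : fapply (fun p q => F p q + G p q) v p = _).
    by rewrite FG mulr0.
  by rewrite -big_split; apply: eq_bigr => q _; rewrite mulrDl.
split; apply: psd_kernel => //; rewrite -E.
  by rewrite lerDl.
by rewrite lerDr.
Qed.

Lemma fapply_kernel_or_inverse F :
  (exists2 v, exists p, v p != 0 & fapply F v =1 (fun=> 0)) \/
  (exists G, forall v, fapply G (fapply F v) =1 v).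
Proof.
pose M := \matrix_(a, b) F (@enum_val T T a) (@enum_val T T b).
have ME (w : 'cV_#|T|) a :
    (M *m w) a 0 = fapply F (fun p => w (enum_rank p) 0) (enum_val a).
  rewrite mxE /fapply (reindex (@enum_val T T)) /=; last first.
    by exists enum_rank => x _; rewrite ?enum_valK ?enum_rankK.
  by apply: eq_bigr => b _; rewrite !mxE enum_valK.
have [Mu|] := boolP (M^T \in unitmx); last first.
  rewrite unitmxE unitfE negbK => /det0P [w w0 wM]; left.
  exists (fun p => w^T (enum_rank p) 0).
    have /rV0Pn [a wa] := w0.
    by exists (enum_val a); rewrite enum_valK mxE.
  move=> p; rewrite -[p]enum_rankK -ME -[M]trmxK -trmx_mul wM trmx0 mxE //.
right; rewrite unitmx_tr in Mu.
exists (fun p q => invmx M (enum_rank p) (enum_rank q)) => v p.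
pose w : 'cV_#|T| := \col_a v (enum_val a).
transitivity ((invmx M *m (M *m w)) (enum_rank p) 0); last first.
  by rewrite mulKmx // mxE enum_rankK.
rewrite mxE /fapply (reindex (@enum_val T T)) /=; last first.
  by exists enum_rank => x _; rewrite ?enum_valK ?enum_rankK.
apply: eq_bigr => a _; rewrite enum_valK ME; congr (_ * _).
by apply: eq_bigr => q _; rewrite mxE enum_rankK.
Qed.

(** If F has an inverse G, then |v|^2 = |G F v|^2 is controlled by |F v|^2, and
the latter by the form of F at v ([psd_fapply]). *)
Lemma psd_dichotomy F : (forall v, 0 <= sform F v v) ->
  (exists2 v, exists p, v p != 0 & fapply F v =1 (fun=> 0)) \/
  (exists2 c, 0 < c & forall v, c * normsq v <= sform F v v).
Proof.
move=> F0; have [|[G GF]] := fapply_kernel_or_inverse F; [by left | right].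
have [c c0 cG] := fapply_bound G.
exists (c * fbound F)^-1 => [|v].
  by rewrite invr_gt0 mulr_gt0 ?fbound_gt0.
rewrite ler_pdivrMl ?mulr_gt0 ?fbound_gt0 // -mulrA.
apply: le_trans (_ : c * normsq (fapply F v) <= _).
  apply: le_trans (cG _); rewrite le_eqVlt; apply/orP; left; apply/eqP.
  by apply: eq_bigr => p _; rewrite GF.
by rewrite ler_pM2l // psd_fapply.
Qed.

End PositiveForms.

(** * Positive elements of finite dimensional operator systems *)

Section MatrixSystemKernels.
Variables (R : realType) (k : nat) (T : matrixOS R k).
Local Notation C := R[i].
Local Notation S := (mos_opSystem T).

(** Kernel vectors of x as an operator on the direct sum of m copies of C^k. *)
Definition mxker m (x : 'M[S]_m) (xi : 'I_m -> 'cV[C]_k) :=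
  forall i, \sum_j mos_val (x i j) *m xi j = 0.

Definition mxform m (x : 'M[S]_m) := flatmx (map_mx (@mos_val R k T) x).

Lemma mxform_posP m (x : 'M[S]_m) :
  os_pos x <-> forall v, 0 <= sform (mxform x) v v.
Proof. exact: mxposP. Qed.

Lemma mxkerP m (x : 'M[S]_m) xi :
  mxker x xi <-> fapply (mxform x) (fun p => xi p.1 p.2 0) =1 (fun=> 0).
Proof.
have E i a : (\sum_j mos_val (x i j) *m xi j) a 0 =
    fapply (mxform x) (fun p => xi p.1 p.2 0) (i, a).
  rewrite /fapply -(pair_bigA _ (fun j b => mxform x (i, a) (j, b) * xi j b 0)).
  rewrite summxE; apply: eq_bigr => j _; rewrite mxE; apply: eq_bigr => b _.
  by rewrite /mxform /flatmx mxE.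
split=> [x0 [i a]|x0 i]; first by rewrite -E x0 mxE.
by apply/matrixP => a b; rewrite ord1 E x0 mxE.
Qed.

Lemma mxkerD m (x y : 'M[S]_m) xi : os_pos x -> os_pos y ->
  mxker (x + y) xi -> mxker x xi /\ mxker y xi.
Proof.
move=> /mxform_posP x0 /mxform_posP y0 /mxkerP xy.
have [|/mxkerP ? /mxkerP ?] := psd_kernelD x0 y0 (v := fun p => xi p.1 p.2 0).
  move=> p; rewrite -[RHS](xy p); apply: eq_bigr => q _; congr (_ * _).
  by rewrite /mxform /flatmx !mxE.
by split.
Qed.

Lemma mos_pos_dichotomy m (x : 'M[S]_m) : os_pos x ->
  (exists2 xi, exists i, xi i != 0 & mxker x xi) \/
  (exists2 r : R, 0 < r & os_pos (realscale (- r) (os_unit S)%:M + x)).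
Proof.
move=> /mxform_posP x0; have [[v [[i a] v0] vx]|[c c0 cx]] := psd_dichotomy x0.
  left; exists (fun i => \col_a v (i, a)).
    exists i; apply/eqP => /matrixP /(_ a 0); rewrite !mxE => va.
    by rewrite va eqxx in v0.
  apply/mxkerP => p; rewrite -[RHS](vx p); apply: eq_bigr => -[j b] _.
  by rewrite mxE.
right; case: c c0 cx => r s; rewrite ltcE /= => /andP[/eqP -> r0] cx.
exists r => //; apply/mxform_posP => v.
rewrite /mxform mos_val_shift sform_shift rmorphN mulNr addrC subr_ge0.
exact: cx.
Qed.

End MatrixSystemKernels.

Section InvertibleUnit.
Variables (R : realType) (P : opSystem R) (k : nat) (T : matrixOS R k).
Variables (f : {linear P -> mos_opSystem T}) (g : {linear mos_opSystem T -> P}).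
Hypotheses (gK : cancel g f) (fcp : cp f) (gcp : cp g).

(** Since g(1) <= r 1 in P, also 1 <= r f(1), so f(1) has no kernel.  This
replaces unitality of f. *)
Lemma unit_image_invertible : mos_val (f (os_unit P)) \in unitmx.
Proof.
have [r [r0]] := os_unit_dominates (gcp (os_pos_unit (mos_opSystem T) 1)).
move=> /fcp; rewrite map_mx_shift map_mxN -map_mx_comp (eq_map_mx _ gK).
rewrite map_mx_id // => H.
rewrite -unitmx_tr unitmxE unitfE; apply/negP => /det0P [w w0 wh].
have {}wh : mos_val (f (os_unit P)) *m w^T = 0.
  by apply: trmx_inj; rewrite trmx_mul trmxK wh trmx0.
have := H (fun=> w^T); rewrite !big_ord1 -mulmxA; set X := map_mx _ _ _ _.
have -> : X = (r%:C)%C *: mos_val (f (os_unit P)) - 1%:M.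
  by rewrite /X !mxE eqxx /= !mulr1n.
rewrite mulmxBl -scalemxAl wh scaler0 mul1mx sub0r mulmxN mxE oppr_ge0 => W.
have : normsq (w 0) <= 0.
  apply: le_trans W; rewrite mxE le_eqVlt; apply/orP; left; apply/eqP.
  by apply: eq_bigr => i _; rewrite !mxE normCK mulrC.
move=> /normsq_eq0 w00; case/negP: w0; apply/eqP/matrixP => i j.
by rewrite ord1 w00 mxE.
Qed.

End InvertibleUnit.

(** * The unit circle is not a finite spectrum *)

Section UnitCircle.
Variable C : numClosedFieldType.

Lemma cayley_den (a : nat) : (a%:R - 'i : C) != 0.
Proof.
rewrite subr_eq0; apply/eqP => ai.
have : ('i : C) \is Num.real by rewrite -ai realn.
move/CrealP; rewrite conjCi => /eqP; rewrite -subr_eq0 -opprD oppr_eq0.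
by rewrite -mulr2n mulrn_eq0 /= (negPf (neq0Ci _)).
Qed.

(** An explicit sequence of distinct points of the unit circle. *)
Definition cayley (a : nat) : C := (a%:R + 'i) / (a%:R - 'i).

Lemma cayley_norm a : `|cayley a| = 1.
Proof.
rewrite /cayley; have -> : a%:R + 'i = Num.conj (a%:R - 'i) :> C.
  by rewrite rmorphB /= conjCi opprK conjC_nat.
by rewrite normrM normfV norm_conjC divff // normr_eq0 cayley_den.
Qed.

Lemma cayley_inj : injective cayley.
Proof.
move=> a b /eqP; rewrite /cayley eqr_div ?cayley_den // -subr_eq0.
have -> : (a%:R + 'i) * (b%:R - 'i) - (b%:R + 'i) * (a%:R - 'i) =
    ((b%:R - a%:R) * 'i) *+ 2 :> C by ring.
rewrite mulrn_eq0 mulf_eq0 (negPf (neq0Ci _)) orbF /= subr_eq0 eqr_nat.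
by move/eqP.
Qed.

Lemma unit_circle_not_spectrum k (N : 'M[C]_k) :
  exists2 z, `|z| = 1 & forall v : 'cV_k, N *m v = z *: v -> v = 0.
Proof.
pose rs := [seq cayley a | a <- iota 0 k.+1].
have [/(max_poly_roots (monic_neq0 (char_poly_monic N^T)))|] :=
    boolP (all (root (char_poly N^T)) rs).
  rewrite size_char_poly size_map size_iota ltnn => H.
  suff /H : uniq rs by [].
  by rewrite map_inj_uniq ?iota_uniq //; apply: cayley_inj.
move=> /allPn [_ /mapP[a _ ->]].
rewrite -eigenvalue_root_char => /eigenvalueP Na.
exists (cayley a) => [|v Nv]; first exact: cayley_norm.
apply/trmx_inj/eqP; rewrite trmx0; apply/negP => /negP v0; apply: Na.
by exists v^T; rewrite // -trmx_mul Nv linearZ.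
Qed.

End UnitCircle.

(** * The full matrix system *)

Definition complete_graph n : sgraph n :=
  @SGraph n (fun i j => i != j) (fun i j => congr1 negb (eq_sym i j))
    (fun i => negbF (eqxx i)).

Section FullMatrixSystem.
Variables (R : realType) (n : nat).
Local Notation C := R[i].
Local Notation S := (graph_opASystem R (complete_graph n.+1)).
Local Notation D := (diagAlg R n).

Lemma complete_graph_full (A : 'M[C]_n.+1) :
  A \in graph_set (complete_graph n.+1).
Proof. by apply/graph_setP => i j _; apply: orbN. Qed.

Definition mx_unit i j : S :=
  @MosElt R n.+1 (graphOS R _) _ (complete_graph_full (delta_mx i j)).

Lemma mx_unitE i j a b : entry (mx_unit i j) a b = ((a == i) && (b == j))%:R.
Proof. by rewrite [LHS]mxE. Qed.

Lemma mx_unit_diag i : mx_unit i i = lact (diag_part (mx_unit i i)) (os_unit S).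
Proof.
apply: entry_inj => a b; rewrite entry_lact diag_partE entry_unit !mx_unitE.
by case: (eqVneq a b) => [->|ab]; rewrite ?mulr1 // mulr0;
  case: eqP => //= <-; rewrite eq_sym (negPf ab).
Qed.

Lemma entryZ (c : C) (s : S) i j : entry (c *: s) i j = c * entry s i j.
Proof. by rewrite [LHS]mxE. Qed.

(** The Choi matrix of the conjugation by the diagonal matrix of c: a multiple
of the projection onto \sum_i c i (e_i (x) e_i). *)
Definition choi (c : 'I_n.+1 -> C) : 'M[S]_n.+1 :=
  \matrix_(i, j) ((c i * Num.conj (c j)) *: mx_unit i j).

Lemma choiE c i j a b :
  entry (choi c i j) a b = c i * Num.conj (c j) *+ ((a == i) && (b == j)).
Proof. by rewrite mxE entryZ mx_unitE mulr_natr. Qed.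

Lemma choi_pos c : os_pos (choi c).
Proof.
apply/graph_posP => v; pose s := \sum_i Num.conj (v (i, i)) * c i.
suff -> : sform (entries (choi c)) v v = `|s| ^+ 2 by apply: exprn_ge0.
have diag_sum (F : 'I_n.+1 -> C) :
    \sum_(p : 'I_n.+1 * 'I_n.+1) F p.1 *+ (p.2 == p.1) = \sum_i F i.
  rewrite -(pair_bigA _ (fun i a => F i *+ (a == i))) /=.
  apply: eq_bigr => i _; rewrite (bigD1 i) //= eqxx big1 ?addr0 // => a.
  by move=> /negPf ->.
have E p q : Num.conj (v p) * entries (choi c) p q * v q =
    (Num.conj (v (p.1, p.1)) * c p.1 *
      (Num.conj (c q.1) * v (q.1, q.1) *+ (q.2 == q.1))) *+ (p.2 == p.1).
  case: p q => [i a] [j b]; rewrite /entries choiE /=.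
  case: eqP => [->|_] /=; last by rewrite !mulr0n mulr0 mul0r.
  case: eqP => [->|_] /=; last by rewrite !mulr0n !mulr0 mul0r.
  by rewrite !mulr1n; ring.
rewrite /sform; under eq_bigr do under eq_bigr do rewrite E.
under eq_bigr do rewrite sumrMnl -mulr_sumr.
under eq_bigr do rewrite (diag_sum (fun j => Num.conj (c j) * v (j, j))).
rewrite (diag_sum (fun i => Num.conj (v (i, i)) * c i * _)) -mulr_suml normCK.
congr (_ * _); rewrite rmorph_sum; apply: eq_bigr => i _.
by rewrite rmorphM /= conjCK mulrC.
Qed.

(** On the i-th component of a kernel vector, 1 and e_ii act in the same way. *)
Definition off_units : 'M[S]_n.+1 :=
  \matrix_(i, j) ((os_unit S - mx_unit i i) *+ (i == j)).

Lemma off_unitsE i j a b :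
  entry (off_units i j) a b = ((i == j) && (a == b) && (a != i))%:R.
Proof.
rewrite mxE; case: eqP => [_|_] /=; last by rewrite [LHS]mxE.
rewrite mulr1n -scaleN1r addrC entryP mx_unitE entry_unit.
case: (eqVneq a i) => [->|_] /=; last by rewrite mulr0 add0r andbT.
by rewrite eq_sym andbF mulN1r addNr.
Qed.

Lemma off_units_pos : os_pos off_units.
Proof.
apply/graph_posP => v; apply: sumr_ge0 => p _.
rewrite (bigD1 p) //= big1 ?addr0 => [|q qp].
  rewrite /entries off_unitsE !eqxx /= mulrAC -normCKC.
  by case: (_ == _); rewrite ?mulr0 ?mulr1 // exprn_ge0.
rewrite /entries off_unitsE -[(_ == _) && _]xpair_eqE -!surjective_pairing.
by rewrite eq_sym (negPf qp) mulr0 mul0r.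
Qed.

(** The positive functional X |-> <X w, w> on M_n(M_n) given by the maximally
entangled vector w = \sum_i e_i (x) e_i. *)
Definition entangled (X : 'M[S]_n.+1) : C := \sum_i \sum_j entry (X i j) i j.

Lemma entangled_pos X : os_pos X -> 0 <= entangled X.
Proof.
move=> /graph_posP /(_ (fun p => (p.1 == p.2)%:R)); congr (0 <= _).
rewrite /sform -(pair_bigA _ (fun i a => \sum_q
  Num.conj ((i == a)%:R) * entries X (i, a) q * (q.1 == q.2)%:R)) /=.
apply: eq_bigr => i _; rewrite (bigD1 i) //=.
rewrite [X in _ + X]big1 ?addr0; last first.
  move=> a /negPf ai; rewrite eq_sym ai big1 // => q _.
  by rewrite conjC0 !mul0r.
rewrite -(pair_bigA _ (fun j b =>
  Num.conj ((i == i)%:R) * entries X (i, i) (j, b) * (j == b)%:R)) /=.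
apply: eq_bigr => j _; rewrite (bigD1 j) //= [X in _ + X]big1 ?addr0.
  by rewrite !eqxx conjC1 mul1r mulr1.
by move=> b /negPf bj; rewrite eq_sym bj mulr0.
Qed.

Lemma entangledD X Y : entangled (X + Y) = entangled X + entangled Y.
Proof.
rewrite -big_split; apply: eq_bigr => i _; rewrite -big_split.
by apply: eq_bigr => j _; rewrite mxE entryD.
Qed.

Lemma entangledN X : entangled (- X) = - entangled X.
Proof.
have entangled0 : entangled 0 = 0.
  by apply: (addrI (entangled 0)); rewrite -entangledD !addr0.
by apply: (addrI (entangled X)); rewrite -entangledD !subrr.
Qed.

Lemma entangledZ r X : entangled (realscale r X) = (r%:C)%C * entangled X.
Proof.
rewrite mulr_sumr; apply: eq_bigr => i _; rewrite mulr_sumr.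
by apply: eq_bigr => j _; rewrite mxE entryZ.
Qed.

Lemma entangled_unit : entangled (os_unit S)%:M = n.+1%:R.
Proof.
rewrite -[n.+1 in RHS]card_ord -sumr_const; apply: eq_bigr => i _.
rewrite (bigD1 i) //= mxE eqxx mulr1n entry_unit eqxx big1 ?addr0 // => j.
by rewrite mxE eq_sym => /negPf ->; rewrite [LHS]mxE.
Qed.

(** The vector of a Choi matrix pairs with w to \sum_i c i. *)
Lemma entangled_choi c : \sum_i c i = 0 -> entangled (choi c) = 0.
Proof.
move=> c0; rewrite /entangled.
under eq_bigr do under eq_bigr do rewrite choiE !eqxx mulr1n.
under eq_bigr do rewrite -mulr_sumr.
by rewrite -mulr_suml c0 mul0r.
Qed.

(** The i-th block of w is e_i, which 1 - e_ii kills. *)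
Lemma entangled_off_units : entangled off_units = 0.
Proof.
rewrite /entangled big1 // => i _; rewrite big1 // => j _.
by rewrite off_unitsE eqxx andbF.
Qed.

Variable d : 'I_n.+1 -> C.
Hypothesis d1 : forall i, `|d i| = 1.

Fact unitary_diag_subproof : diag_mx (\row_i d i) \in @diag_pred R n.
Proof. exact: diag_mx_is_diag. Qed.
Definition unitary_diag : D := DiagElt unitary_diag_subproof.

Lemma unitary_diagE i : dentry unitary_diag i = d i.
Proof. by rewrite /dentry !mxE eqxx. Qed.

Definition rotate (s : S) : S :=
  ract (lact unitary_diag s) (sa_star unitary_diag).

Fact rotate_linear : linear rotate.
Proof. by move=> c s t; rewrite /rotate lact_linearr ract_linearl. Qed.
HB.instance Definition _ := GRing.isLinear.Build C S S _ rotate rotate_linear.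

Lemma rotateE s i j : entry (rotate s) i j = d i * entry s i j * Num.conj (d j).
Proof. by rewrite entry_ract entry_lact dentry_star !unitary_diagE. Qed.

Lemma rotate_ucp : ucp rotate.
Proof.
split.
  apply: entry_inj => i j; rewrite rotateE entry_unit.
  by case: eqP => [->|_]; rewrite ?mulr0 ?mul0r // mulr1 -normCK d1 expr1n.
move=> m x /graph_posP x0; apply/graph_posP => v.
have := x0 (fun p => Num.conj (d p.2) * v p); congr (0 <= _).
apply: eq_bigr => p _; apply: eq_bigr => q _.
by rewrite /entries mxE rotateE rmorphM /= conjCK; ring.
Qed.

Lemma rotate_bimodule : bimodule_map rotate.
Proof.
move=> a b s; apply: entry_inj => i j.
by rewrite rotateE !entry_ract !entry_lact rotateE; ring.
Qed.

Lemma rotate_choi c : map_mx rotate (choi c) = choi (fun i => d i * c i).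
Proof.
apply/matrixP => i j; rewrite mxE; apply: entry_inj => a b.
rewrite rotateE !choiE rmorphM /=.
case: eqP => [->|_]; case: eqP => [->|_]; rewrite /= ?mulr0n ?mulr0 ?mul0r //.
by rewrite !mulr1n; ring.
Qed.

End FullMatrixSystem.

(** * The coproduct of two full 2 x 2 matrix systems *)

Section NotFiniteDimensional.
Variable R : realType.
Local Notation C := R[i].
Local Notation S := (graph_opASystem R (complete_graph 2)).
Local Notation D := (diagAlg R 1).
Variables (P : opASystem D) (phi1 phi2 : {linear S -> P}).
Hypothesis copP : is_coproduct phi1 phi2.

Definition phase (z : C) (i : 'I_2) : C := if i == 0 then 1 else z.

(** Under a representation of P by 2 x 2 matrices in which phi2 is phi1
conjugated by diag(1, conj z), each of the three summands annihilates the
maximally entangled vector: the first because e_ii fixes e_i, the others because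
the coefficients 1 and -1, respectively 1 and - z * conj z, sum to 0. *)
Definition singular_witness (z : C) : 'M[P]_2 :=
  map_mx phi1 (off_units R 1) + map_mx phi1 (choi (phase (-1))) +
  map_mx phi2 (choi (phase (- z))).

Lemma phase_sum z : \sum_i phase z i = 1 + z.
Proof. by rewrite big_ord_recl big_ord1. Qed.

Lemma witness_annihilated z : `|z| = 1 ->
  exists Psi : {linear P -> S}, ucp Psi /\
    entangled (map_mx Psi (singular_witness z)) = 0.
Proof.
move=> z1; have [_ _ _ univ] := copP.
pose d := phase (Num.conj z).
have d1 i : `|d i| = 1.
  by rewrite /d /phase; case: (_ == _); rewrite ?normr1 // norm_conjC.
have [Psi [Psi_ucp _ Psi1 Psi2] _] := univ S idfun (rotate d) (ucp_id _)
  (@bimodule_id _ _ _) (rotate_ucp d1) (@rotate_bimodule _ _ d).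
exists Psi; split=> //.
rewrite !map_mxD -!map_mx_comp !(eq_map_mx _ Psi1) (eq_map_mx _ Psi2).
rewrite !(map_mx_id (frefl _)).
rewrite !entangledD entangled_off_units [X in _ + entangled X]rotate_choi.
rewrite !entangled_choi ?addr0 //.
  rewrite big_ord_recl big_ord1 /d /phase /= mulr1 mulrN mulrC -normCK z1.
  by rewrite expr1n subrr.
by rewrite phase_sum subrr.
Qed.

Lemma phi_mx_unit_diag i : phi1 (mx_unit R i i) = phi2 (mx_unit R i i).
Proof.
have [_ [u1 _ b1] [u2 _ b2] _] := copP.
by rewrite mx_unit_diag (bimodule_lact b1) (bimodule_lact b2) u1 u2.
Qed.

Variables (k : nat) (T : matrixOS R k).
Variables (f : {linear P -> mos_opSystem T}) (g : {linear mos_opSystem T -> P}).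
Hypotheses (fK : cancel f g) (gK : cancel g f) (fcp : cp f) (gcp : cp g).

Lemma map_gf m (x : 'M[P]_m) : map_mx g (map_mx f x) = x.
Proof. by rewrite -map_mx_comp (eq_map_mx _ fK) map_mx_id. Qed.

(** Otherwise the image of the witness dominates r times the unit of T.  Pull
this back by g and evaluate: the functional of [witness_annihilated] would be
nonpositive at g(1), although g(1) dominates a positive multiple of the unit
of P, where the functional is 2. *)
Lemma witness_singular z : `|z| = 1 ->
  exists2 xi, exists i, xi i != 0 & mxker (map_mx f (singular_witness z)) xi.
Proof.
move=> z1; have [_ [_ [_ e1] _] [_ [_ e2] _] _] := copP.
have y0 : os_pos (singular_witness z).
  apply: os_posD; first apply: os_posD.
  - exact/e1/off_units_pos.
  - exact/e1/choi_pos.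
  - exact/e2/choi_pos.
have [//|[r r0 Yr]] := mos_pos_dichotomy (fcp y0).
have [Psi [[Psi1 Psicp] Psiy]] := witness_annihilated z1.
pose t := entangled (Psi (g (os_unit _)))%:M.
have t_le0 : 0 <= (- r)%:C%C * t.
  have := entangled_pos (Psicp _ _ (gcp Yr)).
  rewrite map_mx_shift map_gf map_mx_shift.
  by rewrite entangledD Psiy addr0 entangledZ.
have [s [s0 es]] := os_unit_dominates (fcp (os_pos_unit P 2)).
have := entangled_pos (Psicp _ _ (gcp es)).
rewrite map_mx_shift map_mxN map_gf map_mx_shift map_mxN.
rewrite map_mx_diag Psi1 entangledD entangledZ -/t entangledN entangled_unit.
rewrite subr_ge0 => st.
have t_gt0 : 0 < t.
  rewrite -(pmulr_rgt0 _ (_ : 0 < s%:C%C)) ?ltcR //.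
  by apply: lt_le_trans st; rewrite ltr0n.
by move: t_le0; rewrite rmorphN mulNr oppr_ge0 pmulr_rle0 ?ltcR // lt_geF.
Qed.

Let h := mos_val (f (os_unit P)).
Let M1 i j := mos_val (f (phi1 (mx_unit R i j))).
Let M2 i j := mos_val (f (phi2 (mx_unit R i j))).

Lemma mxker_choi (phi : {linear S -> P}) c xi i :
  mxker (map_mx f (map_mx phi (choi c))) xi ->
  \sum_j (c i * Num.conj (c j)) *:
    (mos_val (f (phi (mx_unit R i j))) *m xi j) = 0.
Proof.
move=> /(_ i) ker; rewrite -[RHS]ker; apply: eq_bigr => j _.
by rewrite !mxE !linearZ /= scalemxAl.
Qed.

Lemma mxker_off_units xi i :
  mxker (map_mx f (map_mx phi1 (off_units R 1))) xi ->
  h *m xi i = M1 i i *m xi i.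
Proof.
move=> /(_ i); rewrite (bigD1 i) //= big1 ?addr0 => [|j]; last first.
  by rewrite !mxE eq_sym => /negPf ->; rewrite !linear0 mul0mx.
have [_ [u1 _ _] _ _] := copP.
rewrite !mxE eqxx mulr1n !linearB /= mulmxBl u1 => /eqP; rewrite subr_eq0.
by move/eqP.
Qed.

(** Let (xi0, xi1) be a kernel vector.  The summand [off_units] turns
f(e_ii) xi_i into h xi_i; the first row for phi1 then reads
h xi0 = f(e'_01) xi1 and the second row for phi2 reads
h xi1 = z f(e''_10) xi0.  Eliminating xi0 leaves an eigenvector xi1, nonzero
because xi1 = 0 would force xi0 = 0. *)
Lemma unimodular_eigenvalue z : `|z| = 1 ->
  exists2 v : 'cV_k, v != 0 &
    invmx h *m M2 1 0 *m invmx h *m M1 0 1 *m v = Num.conj z *: v.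
Proof.
move=> z1; have [xi [i0 xi0] ker] := witness_singular z1.
have [_ [_ [_ e1] _] [_ [_ e2] _] _] := copP.
have p0 : os_pos (map_mx f (map_mx phi1 (off_units R 1))).
  exact/fcp/e1/off_units_pos.
have p1 : os_pos (map_mx f (map_mx phi1 (choi (phase (-1))))).
  exact/fcp/e1/choi_pos.
have p2 : os_pos (map_mx f (map_mx phi2 (choi (phase (- z))))).
  exact/fcp/e2/choi_pos.
move: ker; rewrite !map_mxD => /(mxkerD (os_posD p0 p1) p2) [/(mxkerD p0 p1)].
move=> [k0 k1 k2].
have hu : h \in unitmx := unit_image_invertible gK fcp gcp.
pose i1 : 'I_2 := lift ord0 ord0.
have i1E : 1 = i1 by apply: val_inj.
have zz : Num.conj z * z = 1 by rewrite -normCKC z1 expr1n.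
have U : h *m xi 0 = M1 0 1 *m xi 1.
  have := mxker_choi 0 k1; rewrite big_ord_recl big_ord1 /phase /= -/i1 -i1E.
  rewrite -(mxker_off_units 0 k0) conjC1 rmorphN1 !mul1r scale1r scaleN1r.
  by move/eqP; rewrite subr_eq0 => /eqP.
have V : h *m xi 1 = z *: (M2 1 0 *m xi 0).
  have := mxker_choi 1 k2; rewrite big_ord_recl big_ord1 /phase /= -/i1 -i1E.
  (* The diagonal units of the two copies agree in P. *)
  rewrite -phi_mx_unit_diag -(mxker_off_units 1 k0) rmorphN /= mulrNN -normCK.
  rewrite z1 expr1n scale1r conjC1 mulr1 scaleNr addrC.
  by move/eqP; rewrite subr_eq0 => /eqP.
exists (xi 1).
  apply: contraNneq xi0 => x1; move: U; rewrite x1 mulmx0 => U.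
  have x0 : xi 0 = 0 by rewrite -[xi 0](mulKmx hu) U mulmx0.
  apply/eqP; case: i0 => [[|[|//]] i0]; [rewrite -[RHS]x0 | rewrite -[RHS]x1].
    by congr xi; apply: val_inj.
  by congr xi; apply: val_inj.
rewrite -!mulmxA -U mulKmx //.
by rewrite -[X in _ = _ *: X](mulKmx hu) V -scalemxAr scalerA zz scale1r.
Qed.

End NotFiniteDimensional.

Theorem coproduct_not_matrix_system (R : realType)
    (P : opASystem (diagAlg R 1))
    (phi1 phi2 : {linear graph_opASystem R (complete_graph 2) -> P}) :
  is_coproduct phi1 phi2 -> forall k (T : matrixOS R k),
  ~ completely_order_isomorphic P (mos_opSystem T).
Proof.
move=> copP k T [f [g [fK gK fcp gcp]]].
pose h := mos_val (f (os_unit P)).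
have [z z1 zN] := unit_circle_not_spectrum
  (invmx h *m mos_val (f (phi2 (mx_unit R 1 0))) *m invmx h *m
   mos_val (f (phi1 (mx_unit R 0 1)))).
have [|v v0 vN] := unimodular_eigenvalue copP fK gK fcp gcp (z := Num.conj z).
  by rewrite norm_conjC.
by case/eqP: v0; apply: zN; rewrite [LHS]vN conjCK.
Qed.

Theorem proposition5p1 (R : realType) :
  exists (n : nat) (G1 G2 : sgraph n.+1),
    (exists (P : opASystem (diagAlg R n))
            (phi1 : {linear graph_opASystem R G1 -> P})
            (phi2 : {linear graph_opASystem R G2 -> P}),
        is_coproduct phi1 phi2) /\
    (forall (P : opASystem (diagAlg R n))
            (phi1 : {linear graph_opASystem R G1 -> P})
            (phi2 : {linear graph_opASystem R G2 -> P}),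
        is_coproduct phi1 phi2 ->
        (forall (k : nat) (G' : sgraph k),
            ~ completely_order_isomorphic P (graph_opSystem R G')) /\
        (forall (k : nat) (T : matrixOS R k),
            ~ completely_order_isomorphic P (mos_opSystem T))).
Proof.
exists 1%N, (complete_graph 2), (complete_graph 2); split.
  exists (@cop_opASystem R 1 (complete_graph 2) (complete_graph 2)).
  exists (@cop_inl R 1 (complete_graph 2) (complete_graph 2)).
  exists (@cop_inr R 1 (complete_graph 2) (complete_graph 2)).
  exact: graph_coproduct_exists.
move=> P phi1 phi2 copP.
by split=> k T; exact: coproduct_not_matrix_system copP _ _.
Qed.
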